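(* Let $d,m$ be positive integers with $m\geqslant2$, let $1<p\leqslant2$, let $0<\varepsilon\leqslant1$, let $k\geqslant d$ be an integer, and set \[ C=C(d,m,p,\varepsilon,k)\coloneqq\exp\Big(\frac{24d\ln m}{\varepsilon^{4d}(p-1)^d}\,k^d\Big). \] Let $n\geqslant C$ be an integer, let $\mathcal{X}$ be a set with $|\mathcal{X}|=m$, and let $\boldsymbol{X}=\langle X_s:s\in\binom{[n]}{d}\rangle$ be an $\mathcal{X}$-valued, $(1/C)$-spreadable, $d$-dimensional random array on $[n]$. Assume there exists $\mathcal{S}\subseteq\mathcal{X}$ with $|\mathcal{S}|=|\mathcal{X}|-1$ such that for every $a\in\mathcal{S}$, \[ \Big|\mathbb{P}\Big(\bigcap_{s\in\mathrm{Box}(d)}[X_s=a]\Big)-\prod_{s\in\mathrm{Box}(d)}\mathbb{P}([X_s=a])\Big|\leqslant\frac1C. \] Then for every $f\colon\mathcal{X}^{\binom{[n]}{d}}\to\mathbb{R}$ with $\mathbb{E}[f(\boldsymbol{X})]=0$ and $\|f(\boldsymbol{X})\|_{L_p}=1$ there exists an interval $I$ of $[n]$ with $|I|=k$ such that for every $J\subseteq I$ with $|J|\geqslant d$, \[ \mathbb{P}\big(\big|\mathbb{E}[f(\boldsymbol{X})\,|\,\mathcal{F}_J]\big|\leqslant\varepsilon\big)\geqslant1-\varepsilon. \]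
   Context: $[n]=\{1,\dots,n\}$, $\binom{I}{d}$ is the set of $d$-element subsets of $I$. For $J\subseteq[n]$ with $|J|\geqslant d$, $\boldsymbol{X}_J=\langle X_s:s\in\binom{J}{d}\rangle$ and $\mathcal{F}_J=\sigma(\{X_s:s\in\binom{J}{d}\})$. $\boldsymbol{X}$ is $\eta$-spreadable if for all $J,K\subseteq[n]$ with $|J|=|K|\geqslant d$ the laws of $\boldsymbol{X}_J,\boldsymbol{X}_K$ (identified via the increasing bijection $J\to K$) are at total variation distance at most $\eta$. $\mathrm{Box}(d)=\{s\in\binom{[n]}{d}:|s\cap\{2i-1,2i\}|=1\text{ for all }i\in[d]\}$. An interval of $[n]$ is a set of consecutive integers. *)

(* Defs.v *)
From HB Require Import structures.
From mathcomp Require Import all_boot all_order all_algebra.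
From mathcomp Require Import all_classical all_reals all_analysis.
Set Implicit Arguments. Unset Strict Implicit. Unset Printing Implicit Defensive.
Import Order.TTheory GRing.Theory Num.Theory.
Local Open Scope ring_scope.

Definition dsub (n d : nat) := {s : {set 'I_n} | #|s| == d}.

Definition config (T : finType) (n d : nat) := {ffun dsub n d -> T}.

Section Defs.
Variable R : realType.
Variables (T : finType) (n d : nat).
Notation cfg := (config T n d).

(* The law of the random array X : a probability mass function on configurations. *)
Definition is_pmf (P : cfg -> R) := (forall x, 0 <= P x) /\ \sum_x P x = 1.

Definition Prob (P : cfg -> R) (A : pred cfg) : R := \sum_(x | A x) P x.
Definition Expect (P : cfg -> R) (f : cfg -> R) : R := \sum_x P x * f x.

Definition Lpnorm (P : cfg -> R) (f : cfg -> R) (p : R) : R :=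
  (\sum_x P x * (`|f x| `^ p)) `^ (p^-1).

(* Law of X_J, where J = phi([j]) and phi : [j] -> [n] is the increasing
   bijection onto J; X_J is relabelled as an array on binom([j], d). *)
Definition lawJ (P : cfg -> R) (j : nat) (phi : 'I_j -> 'I_n)
    (y : config T j d) : R :=
  \sum_(x : cfg | [forall t : dsub j d, forall s : dsub n d,
                     (val s == phi @: val t) ==> (x s == y t)]) P x.

Definition dTV (j : nat) (mu nu : config T j d -> R) : R :=
  2^-1 * \sum_y `|mu y - nu y|.

Definition strictly_increasing (j : nat) (phi : 'I_j -> 'I_n) :=
  forall a b : 'I_j, (a < b)%N -> (phi a < phi b)%N.

Definition spreadable (P : cfg -> R) (eta : R) :=
  forall (j : nat), (d <= j)%N ->
  forall phi psi : 'I_j -> 'I_n,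
    strictly_increasing phi -> strictly_increasing psi ->
    dTV (lawJ P phi) (lawJ P psi) <= eta.

(* x and y agree on binom(J, d), i.e. on the generators of F_J *)
Definition agreeJ (J : {set 'I_n}) (x y : cfg) : bool :=
  [forall s : dsub n d, (val s \subset J) ==> (x s == y s)].

(* E[f(X) | F_J] evaluated at the outcome x (a version of the conditional
   expectation; on null atoms it is 0, which does not affect probabilities). *)
Definition condE (P : cfg -> R) (f : cfg -> R) (J : {set 'I_n}) (x : cfg) : R :=
  (\sum_(y | agreeJ J x y) P y * f y) / (\sum_(y | agreeJ J x y) P y).

(* Box(d) (0-indexed: pairs {2i, 2i+1}, i < d) *)
Definition inBox (s : dsub n d) : bool :=
  [forall i : 'I_d,
     #|val s :&: [set u : 'I_n | (u == (2 * i)%N :> nat) || (u == (2 * i).+1 :> nat)]| == 1%N].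

Definition is_interval_of_size (I : {set 'I_n}) (k : nat) :=
  exists a : nat, (a + k <= n)%N /\
    I = [set u : 'I_n | (a <= u)%N && (u < a + k)%N].

End Defs.

Definition constC (R : realType) (d m k : nat) (p eps : R) : R :=
  expR ((24 * d%:R * ln m%:R) / (eps ^+ (4 * d) * (p - 1) ^+ d) * k%:R ^+ d).

(* Main.v *)
Require Import Defs.
From HB Require Import structures.
From mathcomp Require Import all_boot all_order all_algebra.
From mathcomp Require Import all_classical all_reals all_analysis.
From mathcomp Require Import ring lra zify.
Set Implicit Arguments. Unset Strict Implicit. Unset Printing Implicit Defensive.
Import Order.TTheory GRing.Theory Num.Theory.
Local Open Scope ring_scope.

(* Put x = 1 / (eps^4 (p - 1)) and let L be an integer with 2x < L <= 2x + 1, l = k L.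

   By spreadability an entry X_s may be averaged over the positions of its d vertices inside d long
   disjoint intervals. The box hypothesis says that the averages of products of [X_s = a] over
   combinatorial boxes are almost as small as the Cauchy-Schwarz inequality allows; the near-equality
   case makes [X_s = a] almost uncorrelated, with error O(C^(-1/2^d)), with every product of bounded
   functions each of which ignores one vertex of s, hence with every event of the form
   [X_t = c_t for t in D], s not in D. Since C is exponential in (k x)^d, this survives a summation
   over all the configurations on [0, l): the restriction of X to [0, l) is close in total variation
   to an array with independent entries.

   Split [0, l) into L blocks of length k. If on each of them some E[f | F_J] took values larger than
   eps with probability larger than eps, then, h_j being its sign, E[f sum_j (h_j - c_j)] > L eps^2 =: t
   for all constants c_j. But with c_j the mean of h_j under the product law, the h_j - c_j are almost
   independent, so by Hoeffding's inequality the sum divided by t has norm at most 1 in L_q,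
   q = p / (p - 1); this contradicts Hoelder's inequality. *)

(** * Decoupling by box norms *)

Section FiniteExpectation.
Variable R : realFieldType.

Definition Ex (I : finType) (w F : I -> R) : R := \sum_i w i * F i.
Definition pmf (I : finType) (w : I -> R) := (forall i, 0 <= w i) /\ \sum_i w i = 1.

Lemma eq_Ex (I : finType) (w F G : I -> R) : F =1 G -> Ex w F = Ex w G.
Proof. by move=> FG; apply: eq_bigr => i _; rewrite FG. Qed.

Lemma ExD (I : finType) (w F G : I -> R) :
  Ex w (fun i => F i + G i) = Ex w F + Ex w G.
Proof. by rewrite -big_split; apply: eq_bigr => i _; rewrite mulrDr. Qed.

Lemma ExZ (I : finType) (w F : I -> R) c : Ex w (fun i => c * F i) = c * Ex w F.
Proof. by rewrite /Ex mulr_sumr; apply: eq_bigr => i _; rewrite mulrCA. Qed.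

Lemma ExZr (I : finType) (w F : I -> R) c : Ex w (fun i => F i * c) = Ex w F * c.
Proof. by rewrite mulrC -ExZ; apply: eq_Ex => i; rewrite mulrC. Qed.

Lemma ExB (I : finType) (w F G : I -> R) :
  Ex w (fun i => F i - G i) = Ex w F - Ex w G.
Proof.
rewrite ExD -[- Ex w G]mulN1r -ExZ; congr (_ + _).
by apply: eq_Ex => i; rewrite mulN1r.
Qed.

Lemma Ex_cst (I : finType) (w : I -> R) c : pmf w -> Ex w (fun=> c) = c.
Proof. by case=> _ w1; rewrite /Ex -mulr_suml w1 mul1r. Qed.

Lemma ler_Ex (I : finType) (w F G : I -> R) :
  pmf w -> (forall i, F i <= G i) -> Ex w F <= Ex w G.
Proof. by case=> w0 _ FG; apply: ler_sum => i _; exact: ler_wpM2l. Qed.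

Lemma Ex_ge0 (I : finType) (w F : I -> R) :
  pmf w -> (forall i, 0 <= F i) -> 0 <= Ex w F.
Proof. by case=> w0 _ F0; apply: sumr_ge0 => i _; exact: mulr_ge0. Qed.

Lemma ler_norm_Ex (I : finType) (w F : I -> R) c :
  pmf w -> (forall i, `|F i| <= c) -> `|Ex w F| <= c.
Proof.
move=> pw0 Fc; have lb : Ex w (fun=> - c) <= Ex w F.
  by apply: ler_Ex => // i; have /ler_normlP[] := Fc i; rewrite lerNl.
have ub : Ex w F <= Ex w (fun=> c) by apply: ler_Ex => // i; have /ler_normlP[] := Fc i.
by rewrite ler_norml; move: lb ub; rewrite !Ex_cst // => -> ->.
Qed.

Lemma Ex_swap (I J : finType) (w : I -> R) (w' : J -> R) F :
  Ex w (fun i => Ex w' (F i)) = Ex w' (fun j => Ex w (fun i => F i j)).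
Proof.
rewrite /Ex; under eq_bigr do rewrite mulr_sumr.
rewrite exchange_big /=; apply: eq_bigr => j _; rewrite mulr_sumr.
by apply: eq_bigr => i _; rewrite mulrCA.
Qed.

Lemma sqr_Ex_le (I : finType) (w F : I -> R) :
  pmf w -> Ex w F ^+ 2 <= Ex w (fun i => F i ^+ 2).
Proof.
move=> pw; set m := Ex w F.
have : 0 <= Ex w (fun i => (F i - m) ^+ 2) by apply: Ex_ge0 => // i; exact: sqr_ge0.
rewrite (@eq_Ex _ _ _ (fun i => F i ^+ 2 + ((- 2 * m) * F i + m ^+ 2))); last by move=> i; ring.
rewrite ExD ExD ExZ Ex_cst // -/m; lra.
Qed.

Definition pairw (I J : finType) (w : I -> R) (w' : J -> R) (p : I * J) : R :=
  w p.1 * w' p.2.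

Lemma Ex_pair (I J : finType) (w : I -> R) (w' : J -> R) F :
  Ex (pairw w w') F = Ex w (fun i => Ex w' (fun j => F (i, j))).
Proof.
rewrite /Ex /pairw; under [RHS]eq_bigr do rewrite mulr_sumr.
by rewrite pair_bigA; apply: eq_bigr => -[i j] _ /=; rewrite mulrA.
Qed.

Lemma pmf_pair (I J : finType) (w : I -> R) (w' : J -> R) :
  pmf w -> pmf w' -> pmf (pairw w w').
Proof.
move=> pw pw'; split=> [p|]; first by apply: mulr_ge0; [case: pw|case: pw'].
transitivity (Ex (pairw w w') (fun=> 1)); first by apply: eq_bigr => p _; rewrite mulr1.
by rewrite Ex_pair (@eq_Ex _ _ _ (fun=> 1)) => [|i]; rewrite Ex_cst.
Qed.

End FiniteExpectation.

Section BoxDecoupling.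
Variables (R : realFieldType) (V : finType) (al : V -> R).
Hypothesis al_pmf : pmf al.

(** The power [V ^ d] is coded as nested pairs, so that inductions on [d] peel off the first
    coordinate by computation. *)
Fixpoint pw (d : nat) : finType :=
  if d is d'.+1 then (V * pw d')%type : finType else unit : finType.

Fixpoint pw_weight d : pw d -> R :=
  if d is d'.+1 then pairw al (@pw_weight d') else fun=> 1.

Lemma pw_weight_pmf d : pmf (@pw_weight d).
Proof.
elim: d => [|d IH]; last exact: pmf_pair.
split=> [i|] /=; first exact: ler01.
by rewrite (eq_bigr (fun=> 1)) // sumr_const card_unit.
Qed.

(* [prodbox g u u'] is the product of [g] over the [2 ^ d] points whose coordinates are taken from
   [u] or [u'], and [box w N] its mean over independent [u] and [u']. *)
Fixpoint prodbox d : (pw d -> R) -> pw d -> pw d -> R :=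
  if d is d'.+1 return (pw d -> R) -> pw d -> pw d -> R then
    fun g u u' => @prodbox d' (fun z => g (u.1, z) * g (u'.1, z)) u.2 u'.2
  else fun g _ _ => g tt.

Lemma eq_prodbox d (g h : pw d -> R) : g =1 h -> prodbox g =2 prodbox h.
Proof.
elim: d g h => [|d IH] g h gh u u' /=; first exact: gh.
by apply: IH => z; rewrite !gh.
Qed.

Lemma prodboxM d (g h : pw d -> R) u u' :
  prodbox (fun z => g z * h z) u u' = prodbox g u u' * prodbox h u u'.
Proof.
elim: d g h u u' => //= d IH g h u u'; rewrite -IH.
by apply: eq_prodbox => z; rewrite mulrACA.
Qed.

Lemma prodbox_ge0 d (g : pw d -> R) u u' : (forall z, 0 <= g z) -> 0 <= prodbox g u u'.
Proof. by elim: d g u u' => //= d IH g u u' g0; apply: IH => z; exact: mulr_ge0. Qed.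

Definition mean d (O : finType) (w : O -> R) (N : O -> pw d -> R) : R :=
  Ex w (fun x => Ex (@pw_weight d) (N x)).

Definition box d (O : finType) (w : O -> R) (N : O -> pw d -> R) : R :=
  Ex w (fun x => Ex (@pw_weight d) (fun u => Ex (@pw_weight d) (fun u' => prodbox (N x) u u'))).

(** One Cauchy-Schwarz step duplicates the first coordinate. The two copies join the parameter
    space, which is why the inductions on [d] quantify over [O]. *)
Definition dbl_weight (O : finType) (w : O -> R) : O * (V * V) -> R := pairw w (pairw al al).

Definition dbl d (O : finType) (N : O -> pw d.+1 -> R) (q : O * (V * V)) (z : pw d) : R :=
  N q.1 (q.2.1, z) * N q.1 (q.2.2, z).

Lemma dbl_weight_pmf (O : finType) (w : O -> R) : pmf w -> pmf (dbl_weight w).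
Proof. by move=> pw; do 2?apply: pmf_pair. Qed.

Lemma box_dbl d (O : finType) (w : O -> R) (N : O -> pw d.+1 -> R) :
  box w N = box (dbl_weight w) (dbl N).
Proof.
rewrite /box /dbl_weight Ex_pair; apply: eq_Ex => x; rewrite Ex_pair Ex_pair.
apply: eq_Ex => v.
rewrite (@eq_Ex _ _ _ _ (fun u => Ex al (fun v' => Ex (@pw_weight d) (fun u' => prodbox (dbl N (x, (v, v'))) u u')))).
  by rewrite Ex_swap.
by move=> u; rewrite Ex_pair.
Qed.

Lemma mean_dbl d (O : finType) (w : O -> R) (N : O -> pw d.+1 -> R) :
  mean (dbl_weight w) (dbl N) = Ex w (fun x => Ex (@pw_weight d) (fun u => Ex al (fun v => N x (v, u)) ^+ 2)).
Proof.
rewrite /mean /dbl_weight Ex_pair; apply: eq_Ex => x; rewrite Ex_pair /dbl /=.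
rewrite (@eq_Ex _ _ _ _ (fun v => Ex (@pw_weight d) (fun u => Ex al (fun v' => N x (v, u) * N x (v', u))))).
  rewrite Ex_swap; apply: eq_Ex => u.
  by rewrite (@eq_Ex _ _ _ _ (fun v => N x (v, u) * Ex al (fun v' => N x (v', u)))) ?ExZr // => v; rewrite ExZ.
by move=> v; rewrite Ex_swap.
Qed.

Lemma mean_slice d (O : finType) (w : O -> R) (N : O -> pw d.+1 -> R) :
  mean w N = Ex w (fun x => Ex (@pw_weight d) (fun u => Ex al (fun v => N x (v, u)))).
Proof. by apply: eq_Ex => x; rewrite Ex_pair Ex_swap. Qed.

Lemma mean_sqr_slice d (O : finType) (w : O -> R) (F : O -> pw d -> R) :
  pmf w -> mean w F ^+ 2 <= mean w (fun x u => F x u ^+ 2).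
Proof.
move=> pw0; have meanE G : mean w G = Ex (pairw w (@pw_weight d)) (fun q => G q.1 q.2) by rewrite Ex_pair.
by rewrite !meanE; apply: sqr_Ex_le; exact: pmf_pair (pw_weight_pmf d).
Qed.

Lemma mean_sqr_dbl d (O : finType) (w : O -> R) (N : O -> pw d.+1 -> R) :
  pmf w -> mean w N ^+ 2 <= mean (dbl_weight w) (dbl N).
Proof. by move=> pw; rewrite mean_slice mean_dbl; exact: mean_sqr_slice. Qed.

Lemma mean_ge0 d (O : finType) (w : O -> R) (N : O -> pw d -> R) :
  pmf w -> (forall x u, 0 <= N x u) -> 0 <= mean w N.
Proof. by move=> pw0 N0; apply: Ex_ge0 => // x; apply: Ex_ge0 => //; exact: pw_weight_pmf. Qed.

Lemma box_ge0 d (O : finType) (w : O -> R) (N : O -> pw d -> R) :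
  pmf w -> (forall x u, 0 <= N x u) -> 0 <= box w N.
Proof.
move=> pw N0; apply: Ex_ge0 => // x; apply: Ex_ge0 => [|u]; first exact: pw_weight_pmf.
by apply: Ex_ge0 => [|u']; [exact: pw_weight_pmf|exact: prodbox_ge0].
Qed.

Lemma dbl_ge0 d (O : finType) (N : O -> pw d.+1 -> R) :
  (forall x u, 0 <= N x u) -> forall q z, 0 <= dbl N q z.
Proof. by move=> N0 q z; exact: mulr_ge0. Qed.

(** Cauchy-Schwarz once per coordinate: the square of a mean is at most the mean of the doubled
    integrand, and [d] doublings lead to [box w N]. *)
Lemma mean_le_box d (O : finType) (w : O -> R) (N : O -> pw d -> R) :
  pmf w -> (forall x u, 0 <= N x u) -> mean w N ^+ (2 ^ d)%N <= box w N.
Proof.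
elim: d O w N => [|d IH] O w N pw N0.
  rewrite expr1 /mean /box.
  apply: ler_Ex => // x; apply: ler_Ex => [|u]; first exact: (pw_weight_pmf 0).
  by rewrite (Ex_cst _ (pw_weight_pmf 0)); case: u.
rewrite box_dbl expnS exprM; apply: le_trans (IH _ _ _ (dbl_weight_pmf pw) (dbl_ge0 N0)).
by rewrite lerXn2r ?nnegrE ?sqr_ge0 ?mean_sqr_dbl ?mean_ge0 //; [exact: dbl_weight_pmf|exact: dbl_ge0].
Qed.

(** For fixed [u], [u'] the box product of [dbl N] splits into a term in [v] and the same term in
    [v'], so its mean is a square, and Cauchy-Schwarz applies in the other variables. The slice
    stays over the doubled parameter space because [decoupling] tests it against functions of both
    copies. *)
Lemma sqr_box_slice_le d (O : finType) (w : O -> R) (N : O -> pw d.+1 -> R) :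
  pmf w -> box (dbl_weight w) (fun q z => N q.1 (q.2.1, z)) ^+ 2 <= box w N.
Proof.
move=> pw0; rewrite box_dbl.
set W := pairw w (pairw (@pw_weight d) (@pw_weight d)).
pose B (q : O * (pw d * pw d)) (v : V) := prodbox (fun z => N q.1 (v, z)) q.2.1 q.2.2.
have boxE (G : V -> V -> O * (pw d * pw d) -> R) :
    Ex (dbl_weight w) (fun q => Ex (@pw_weight d) (fun u => Ex (@pw_weight d) (fun u' => G q.2.1 q.2.2 (q.1, (u, u')))))
    = Ex W (fun q => Ex al (fun v => Ex al (fun v' => G v v' q))).
  rewrite /W /dbl_weight !Ex_pair; apply: eq_Ex => x; rewrite !Ex_pair /=.
  transitivity (Ex al (fun v => Ex (@pw_weight d) (fun u => Ex (@pw_weight d) (fun u' => Ex al (fun v' => G v v' (x, (u, u'))))))).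
    apply: eq_Ex => v; rewrite Ex_swap; apply: eq_Ex => u; exact: Ex_swap.
  rewrite Ex_swap; apply: eq_Ex => u; exact: Ex_swap.
have -> : box (dbl_weight w) (fun q z => N q.1 (q.2.1, z)) = Ex W (fun q => Ex al (B q)).
  rewrite /box (boxE (fun v v' q => B q v)); apply: eq_Ex => q.
  by apply: eq_Ex => v; rewrite /= Ex_cst.
have -> : box (dbl_weight w) (dbl N) = Ex W (fun q => Ex al (B q) ^+ 2).
  rewrite /box /dbl; under eq_Ex => q do under eq_Ex => u do under eq_Ex => u' do rewrite prodboxM.
  rewrite (boxE (fun v v' q => B q v * B q v')); apply: eq_Ex => q.
  by under eq_Ex => v do rewrite ExZ; rewrite ExZr.
by apply: sqr_Ex_le; do 2?apply: pmf_pair => //; exact: pw_weight_pmf.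
Qed.

(* [test Y] : Y is a product of [d] functions bounded by 1, the j-th of which does not depend on
   the j-th coordinate. *)
Fixpoint test d (O : finType) : (O -> pw d -> R) -> Prop :=
  if d is d'.+1 return (O -> pw d -> R) -> Prop then
    fun Y => exists2 Y0 : O -> pw d' -> R, (forall x u, `|Y0 x u| <= 1) &
      exists2 Y' : O * V -> pw d' -> R, @test d' (O * V)%type Y' &
        forall x u, Y x u = Y0 x u.2 * Y' (x, u.1) u.2
  else fun Y => forall x u, Y x u = 1.

Lemma test_le1 d (O : finType) (Y : O -> pw d -> R) x u : test Y -> `|Y x u| <= 1.
Proof.
elim: d O Y x u => [|d IH] O Y x u /=; first by move=> ->; rewrite normr1.
case=> Y0 Y01 [Y' tY'] ->; rewrite normrM mulr_ile1 //; exact: IH.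
Qed.

Lemma eq_test d (O : finType) (Y Z : O -> pw d -> R) :
  (forall x u, Y x u = Z x u) -> test Y -> test Z.
Proof.
case: d Y Z => [|d] Y Z YZ /=; first by move=> Y1 x u; rewrite -YZ.
by case=> Y0 Y01 [Y' tY' YE]; exists Y0 => //; exists Y' => // x u; rewrite -YZ.
Qed.

Lemma test1 d (O : finType) : test (fun (_ : O) (_ : pw d) => 1).
Proof.
elim: d O => //= d IH O; exists (fun _ _ => 1) => [x u|]; first by rewrite normr1.
by exists (fun _ _ => 1) => [|x u]; [exact: IH|rewrite mulr1].
Qed.

Lemma testM d (O : finType) (Y Z : O -> pw d -> R) :
  test Y -> test Z -> test (fun x u => Y x u * Z x u).
Proof.
elim: d O Y Z => [|d IH] O Y Z /=; first by move=> Y1 Z1 x u; rewrite Y1 Z1 mulr1.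
case=> Y0 Y01 [Y' tY' YE] [Z0 Z01 [Z' tZ' ZE]].
exists (fun x u => Y0 x u * Z0 x u); first by move=> x u; rewrite normrM mulr_ile1.
exists (fun x u => Y' x u * Z' x u); first exact: IH.
by move=> x u; rewrite YE ZE mulrACA.
Qed.

Lemma test_comp d (O O' : finType) (h : O' -> O) (Y : O -> pw d -> R) :
  test Y -> test (fun x u => Y (h x) u).
Proof.
elim: d O O' h Y => [|d IH] O O' h Y /=; first by move=> Y1 x u.
case=> Y0 Y01 [Y' tY' YE]; exists (fun x u => Y0 (h x) u) => //.
exists (fun x u => Y' (h x.1, x.2) u) => //.
exact: (IH _ _ (fun x : O' * V => (h x.1, x.2))).
Qed.

Fixpoint pget (v0 : V) d : pw d -> nat -> V :=
  if d is d'.+1 return pw d -> nat -> V then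
    fun u i => if i is i'.+1 then @pget v0 d' u.2 i' else u.1
  else fun _ _ => v0.

(** [F] serves as its own [i]-th factor, the others being 1; [v0] fills the coordinate that [F]
    ignores. *)
Lemma test_indep v0 d (O : finType) (F : O -> pw d -> R) i :
  (i < d)%N -> (forall x u, `|F x u| <= 1) ->
  (forall x u u', (forall j, j != i -> pget v0 u j = pget v0 u' j) -> F x u = F x u') ->
  test F.
Proof.
elim: d O F i => // d IH O F [_|i id] F1 Find /=.
  exists (fun x u => F x (v0, u)) => //; exists (fun _ _ => 1); first exact: test1.
  by move=> x [v u]; rewrite mulr1; apply: Find; case.
exists (fun _ _ => 1) => [x u|]; first by rewrite normr1.
exists (fun x u => F x.1 (x.2, u)); last by move=> x [v u]; rewrite mul1r.
apply: (IH _ _ i) => // x u u' E; apply: Find; case=> // j ji /=; exact: E.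
Qed.

(* Cauchy-Schwarz in one coordinate doubles it; with [D = E N N'], the doubled integrand splits as
   [(N - e) (N' - e) = (N N' - D) - e (N - e) - e (N' - e) + (D - e ^ 2)], where each of the three
   brackets is handled by induction, with [r ^ 2], [r ^ 2 / e] and [r ^ 2 / e] in place of [r]. *)
Lemma decoupling d (O : finType) (w : O -> R) (N Y : O -> pw d -> R) (r : R) :
  pmf w -> (forall x u, 0 <= N x u) -> test Y -> 0 <= r ->
  box w N <= mean w N ^+ (2 ^ d)%N + r ^+ (2 ^ d)%N ->
  `|mean w (fun x u => (N x u - mean w N) * Y x u)| <= d%:R * r.
Proof.
elim: d O w N Y r => [|d IH] O w N Y r pw0 N0 tY r0 Hbox.
  rewrite mul0r normr_le0; apply/eqP.
  have -> : mean w (fun x u => (N x u - mean w N) * Y x u) = mean w (fun x u => N x u - mean w N).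
    by do 2 apply: eq_Ex => ?; rewrite tY mulr1.
  rewrite /mean; under eq_Ex => x do rewrite ExB.
  rewrite ExB -/(mean w N).
  by under eq_Ex => x do rewrite (Ex_cst _ (pw_weight_pmf 0)); rewrite Ex_cst // subrr.
set e := mean w N in Hbox *; have e0 : 0 <= e by exact: mean_ge0.
have pw2 := dbl_weight_pmf pw0.
set D := mean (dbl_weight w) (dbl N).
have eD : e ^+ 2 <= D by exact: mean_sqr_dbl.
have D0 : 0 <= D by exact: le_trans (sqr_ge0 _) eD.
have r20 : 0 <= r ^+ 2 by exact: sqr_ge0.
have Hbox' : box (dbl_weight w) (dbl N) <= (e ^+ 2) ^+ (2 ^ d)%N + (r ^+ 2) ^+ (2 ^ d)%N.
  by rewrite -box_dbl -!exprM -!expnS.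
(* The bracket [D - e ^ 2] costs [r ^ 2]: with [h = 2 ^ d], [D ^ h] is at most the box mean, hence
   at most [(e ^ 2) ^ h + (r ^ 2) ^ h <= (e ^ 2 + r ^ 2) ^ h]. *)
have DE : D <= e ^+ 2 + r ^+ 2.
  rewrite -(@ler_pXn2r _ (2 ^ d)%N) ?expn_gt0 ?nnegrE ?addr_ge0 ?sqr_ge0 //.
  apply: le_trans (mean_le_box pw2 (dbl_ge0 N0)) _; apply: le_trans Hbox' _.
  elim: (2 ^ d)%N (expn_gt0 2 d) => // -[|h] IHh _; first by rewrite !expr1.
  rewrite exprS [X in _ + X]exprS [leRHS]exprS.
  apply: le_trans (_ : (e ^+ 2 + r ^+ 2) * ((e ^+ 2) ^+ h.+1 + (r ^+ 2) ^+ h.+1) <= _).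
    have H1 : 0 <= e ^+ 2 * (r ^+ 2) ^+ h.+1 by rewrite mulr_ge0 ?exprn_ge0 ?sqr_ge0.
    have H2 : 0 <= r ^+ 2 * (e ^+ 2) ^+ h.+1 by rewrite mulr_ge0 ?exprn_ge0 ?sqr_ge0.
    by rewrite mulrDl !mulrDr; lra.
  by apply: ler_wpM2l; [rewrite addr_ge0 ?sqr_ge0|exact: IHh].
case: tY => Y0 Y01 [Y' tY' YE].
pose YY (q : O * (V * V)) u := Y' (q.1, q.2.1) u * Y' (q.1, q.2.2) u.
have tYY : test YY.
  by apply: testM; [exact: (test_comp (fun q : O * (V * V) => (q.1, q.2.1)))
                   |exact: (test_comp (fun q : O * (V * V) => (q.1, q.2.2)))].
pose N1 (q : O * (V * V)) (u : pw d) := N q.1 (q.2.1, u).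
pose N1' (q : O * (V * V)) (u : pw d) := N q.1 (q.2.2, u).
have mN1 : mean (dbl_weight w) N1 = e.
  rewrite /e mean_slice /mean /dbl_weight Ex_pair; apply: eq_Ex => x; rewrite Ex_pair [RHS]Ex_swap.
  by apply: eq_Ex => v; rewrite /N1 /= Ex_cst.
have mN1' : mean (dbl_weight w) N1' = e.
  rewrite /e mean_slice /mean /dbl_weight Ex_pair; apply: eq_Ex => x; rewrite Ex_pair [RHS]Ex_swap.
  by rewrite /N1' /= Ex_cst.
have bN1' : box (dbl_weight w) N1' = box (dbl_weight w) N1.
  rewrite /box /dbl_weight !Ex_pair; apply: eq_Ex => x; rewrite !Ex_pair.
  by rewrite Ex_swap.
have e2 := IH _ _ _ _ _ pw2 (dbl_ge0 N0) tYY r20.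
have {}e2 : `|mean (dbl_weight w) (fun q u => (dbl N q u - D) * YY q u)| <= d%:R * r ^+ 2.
  apply: e2; apply: le_trans Hbox' _; rewrite lerD2r lerXn2r ?nnegrE ?sqr_ge0 //.
have slice_bound (M : O * (V * V) -> pw d -> R) : (forall q u, 0 <= M q u) ->
    mean (dbl_weight w) M = e -> box (dbl_weight w) M = box (dbl_weight w) N1 ->
    `|e * mean (dbl_weight w) (fun q u => (M q u - e) * YY q u)| <= d%:R * r ^+ 2.
  move=> M0 mM bM; have [->|ne0] := eqVneq e 0; first by rewrite mul0r normr0 mulr_ge0.
  have ep : 0 < e by rewrite lt_def ne0.
  have := IH _ _ _ _ (r ^+ 2 / e) pw2 M0 tYY (divr_ge0 r20 e0).
  rewrite mM bM => e1; rewrite normrM ger0_norm // -ler_pdivlMl // mulrC -mulrA; apply: e1.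
  (* Squares are compared: the cross term of [(e ^ h + (r ^ 2 / e) ^ h) ^ 2] is [2 (r ^ 2) ^ h],
     which covers the error allowed by [Hbox]. *)
  set h := (2 ^ d)%N.
  rewrite -(@ler_pXn2r _ 2) ?nnegrE //; last 2 first.
  - by apply: box_ge0 => // q u; exact: N0.
  - by rewrite addr_ge0 ?exprn_ge0 ?divr_ge0.
  apply: le_trans (sqr_box_slice_le N pw0) _; apply: le_trans Hbox _.
  rewrite expnS !exprM -/h -!exprM ![(2 * h)%N]mulnC !exprM expr_div_n.
  have eh : e ^+ h != 0 by rewrite expf_neq0.
  rewrite sqrrD; have -> : e ^+ h * ((r ^+ 2) ^+ h / e ^+ h) = (r ^+ 2) ^+ h.
    by rewrite mulrCA mulfV ?mulr1.
  have -> : (r ^+ h) ^+ 2 = (r ^+ 2) ^+ h by rewrite -!exprM mulnC.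
  rewrite -addrA lerD2l mulr2n -addrA lerDl addr_ge0 ?exprn_ge0 ?divr_ge0 ?exprn_ge0 //.
have e1 := slice_bound N1 (fun q u => N0 _ _) mN1 erefl.
have e1' := slice_bound N1' (fun q u => N0 _ _) mN1' bN1'.
have EYY : `|mean (dbl_weight w) YY| <= 1.
  apply: ler_norm_Ex => // q; apply: ler_norm_Ex; first exact: pw_weight_pmf.
  by move=> u; exact: test_le1.
set Z := mean w _.
(* [Y0] does not see the first coordinate, so it leaves the average over [v]; after Cauchy-Schwarz
   it is bounded by 1. *)
pose F x u := Ex al (fun v => (N x (v, u) - e) * Y' (x, v) u).
have ZE : Z = mean w (fun x u => Y0 x u * F x u).
  rewrite /Z mean_slice; apply: eq_Ex => x; apply: eq_Ex => u.
  by rewrite /F -ExZ; apply: eq_Ex => v; rewrite YE /= mulrCA.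
have Z2 : Z ^+ 2 <= mean w (fun x u => F x u ^+ 2).
  rewrite ZE; apply: le_trans (mean_sqr_slice _ pw0) _.
  apply: ler_Ex => // x; apply: ler_Ex => [|u]; first exact: pw_weight_pmf.
  rewrite exprMn ler_piMl ?sqr_ge0 // -real_normK ?num_real // exprn_ile1 //.
pose dN x (u : pw d.+1) := (N x u - e) * Y' (x, u.1) u.2.
have F2 : mean w (fun x u => F x u ^+ 2) = mean (dbl_weight w) (dbl dN) by rewrite mean_dbl.
have split : mean (dbl_weight w) (dbl dN) =
    mean (dbl_weight w) (fun q u => (dbl N q u - D) * YY q u)
    - e * mean (dbl_weight w) (fun q u => (N1 q u - e) * YY q u)
    - e * mean (dbl_weight w) (fun q u => (N1' q u - e) * YY q u)
    + (D - e ^+ 2) * mean (dbl_weight w) YY.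
  rewrite /mean -!ExZ -!ExB -ExD; apply: eq_Ex => q.
  rewrite -!ExZ -!ExB -ExD; apply: eq_Ex => u.
  rewrite /dbl /dN /YY /N1 /N1' /=; ring.
have De : `|(D - e ^+ 2) * mean (dbl_weight w) YY| <= r ^+ 2.
  rewrite normrM (ger0_norm (_ : 0 <= D - e ^+ 2)) ?subr_ge0 //.
  by apply: le_trans (ler_piMr _ EYY) _; rewrite ?subr_ge0 // lerBlDl.
have Z2' : Z ^+ 2 <= 3 * (d%:R * r ^+ 2) + r ^+ 2.
  apply: le_trans Z2 _; rewrite F2 split.
  move: e2 e1 e1' De; rewrite !ler_norml => /andP[_ ?] /andP[? _] /andP[? _] /andP[_ ?].
  by lra.
rewrite -(@ler_pXn2r _ 2) ?nnegrE ?mulr_ge0 ?ler0n // real_normK ?num_real //.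
apply: le_trans Z2' _.
(* The induction closes because [3 d + 1 <= (d + 1) ^ 2]. *)
have -> : 3 * (d%:R * r ^+ 2) + r ^+ 2 = (3 * d%:R + 1) * r ^+ 2 by ring.
have dd : d%:R <= d%:R * d%:R :> R by rewrite -natrM ler_nat; case: (d) => // ?; rewrite leq_pmulr.
by rewrite exprMn ler_wpM2r // -natr1; lra.
Qed.

End BoxDecoupling.

(** * Subarrays and boxes *)

Section Subarrays.
Variables (T : finType) (d : nat).

Lemma imd_subproof j n (phi : 'I_j -> 'I_n) (h : injective phi) (t : dsub j d) :
  #|phi @: val t| == d.
Proof. by rewrite card_imset //; exact: valP t. Qed.

Definition imd j n (phi : 'I_j -> 'I_n) (h : injective phi) (t : dsub j d) : dsub n d :=
  exist _ (phi @: val t) (imd_subproof h t).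

Definition pull j n (phi : 'I_j -> 'I_n) (h : injective phi) (x : config T n d) :
  config T j d := [ffun t => x (imd h t)].

Lemma pullE j n (phi : 'I_j -> 'I_n) (h : injective phi) x (t : dsub j d) (s : dsub n d) :
  val s = phi @: val t -> pull h x t = x s.
Proof. by move=> st; rewrite ffunE; congr (x _); apply: val_inj. Qed.

Lemma increasing_inj j n (phi : 'I_j -> 'I_n) : strictly_increasing phi -> injective phi.
Proof.
move=> h a b ab; apply: val_inj; case: (ltngtP a b) => // /h; rewrite ab ltnn //.
Qed.

Lemma sum_lawJ (R : realType) j n (P : config T n d -> R) (phi : 'I_j -> 'I_n) (h : injective phi) G :
  Ex (lawJ P phi) G = Ex P (fun x => G (pull h x)).
Proof.
rewrite /Ex (partition_big (pull h) predT) //=; apply: eq_bigr => y _.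
rewrite /lawJ mulr_suml.
have E (x : config T n d) : [forall t : dsub j d, forall s : dsub n d, (val s == phi @: val t) ==> (x s == y t)]
            = (pull h x == y).
  apply/idP/eqP => [/forallP H|<-].
    apply/ffunP => t; have /forallP/(_ (imd h t)) := H t.
    by rewrite /= eqxx /= ffunE => /eqP.
  by apply/forallP => t; apply/forallP => s; apply/implyP => /eqP st; rewrite (pullE h _ st).
by rewrite (eq_bigl _ _ E); apply: eq_bigr => x /eqP ->.
Qed.

(** A test function bounded by 1 sees at most the l1 distance of the two laws, which is twice
    [dTV]. *)
Lemma spreadable_Ex (R : realType) n (P : config T n d -> R) eta j
    (phi psi : 'I_j -> 'I_n) (h : injective phi) (h' : injective psi) (G : config T j d -> R) :
  spreadable P eta -> (d <= j)%N -> strictly_increasing phi -> strictly_increasing psi ->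
  (forall y, `|G y| <= 1) ->
  `|Ex P (fun x => G (pull h x)) - Ex P (fun x => G (pull h' x))| <= 2 * eta.
Proof.
move=> sp dj iphi ipsi G1; rewrite -!sum_lawJ.
have := sp j dj _ _ iphi ipsi; rewrite /dTV => H.
have -> : Ex (lawJ P phi) G - Ex (lawJ P psi) G = \sum_y (lawJ P phi y - lawJ P psi y) * G y.
  by rewrite /Ex -sumrB; apply: eq_bigr => y _; rewrite mulrBl.
apply: le_trans (ler_norm_sum _ _ _) _.
apply: (@le_trans _ _ (\sum_y `|lawJ P phi y - lawJ P psi y|)); last by lra.
by apply: ler_sum => y _; rewrite normrM ler_piMr.
Qed.

Lemma exists_missing n (s t : dsub n d) : s != t -> exists2 v, v \in val s & v \notin val t.
Proof.
move=> st; apply/subsetPn; apply: contra st => sub; apply/eqP/val_inj/eqP.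
by rewrite eqEcard sub /= (eqP (valP s)) (eqP (valP t)).
Qed.

End Subarrays.

Section Box.
Variable d : nat.

Lemma vertex_subproof n (h : (2 * d <= n)%N) (om : {ffun 'I_d -> bool}) (i : 'I_d) :
  (2 * i + om i < n)%N.
Proof. by have := ltn_ord i; case: (om i) => /=; lia. Qed.

(** The cube of functions [om] parametrises the box bijectively; corners of combinatorial boxes are
    indexed in the same way. *)
Definition vertex n h om i : 'I_n := Ordinal (@vertex_subproof n h om i).

Lemma vertex_inj n h om : injective (@vertex n h om).
Proof. by move=> i i' /(congr1 val) /= E; apply: val_inj => /=; move: E; case: (om i); case: (om i') => /=; lia. Qed.

Lemma boxset_subproof n h om : #|[set @vertex n h om i | i : 'I_d]| == d.
Proof. by rewrite card_imset ?card_ord //; exact: vertex_inj. Qed.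

Definition boxset n h om : dsub n d := exist _ [set @vertex n h om i | i : 'I_d] (@boxset_subproof n h om).

Lemma boxset_inj n h : injective (@boxset n h).
Proof.
move=> om om' /(congr1 val) /= E; apply/ffunP => i.
have : vertex h om i \in [set vertex h om' i | i : 'I_d] by rewrite -E imset_f.
case/imsetP => i' _ /(congr1 val) /= Ei.
have ii' : i = i' by apply: val_inj => /=; move: Ei; case: (om i); case: (om' i') => /=; lia.
by move: Ei; rewrite ii'; case: (om i'); case: (om' i') => //=; lia.
Qed.

Lemma pair_cap n h om (i : 'I_d) : val (@boxset n h om) :&:
  [set u : 'I_n | (u == (2 * i)%N :> nat) || (u == (2 * i).+1 :> nat)] = [set vertex h om i].
Proof.
apply/setP => u; rewrite !inE; apply/andP/eqP => [[/imsetP[i' _ ->] /= Ei]|->].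
  by congr vertex; apply: val_inj; move: Ei; case: (om i') => /=; lia.
by rewrite imset_f //; split=> //; case: (om i) => /=; lia.
Qed.

Lemma inBox_boxset n h om : inBox (@boxset n h om).
Proof. by apply/forallP => i; rewrite pair_cap cards1. Qed.

Lemma inBoxE n h (s : dsub n d) : inBox s -> exists om, s = @boxset n h om.
Proof.
move=> /forallP bs.
pose om := [ffun i : 'I_d => [exists u in val s, u == (2 * i).+1 :> nat]].
exists om; apply: val_inj; apply/esym/eqP; rewrite eqEcard; apply/andP; split; last first.
  by rewrite (eqP (valP s)) (eqP (valP (boxset h om))).
apply/fintype.subsetP => _ /imsetP[i _ ->]; have /cards1P[u Eu] := bs i.
have : u \in [set u] by rewrite inE.
rewrite -Eu !inE => /andP[us ui].
have -> // : vertex h om i = u; apply: val_inj => /=; rewrite ffunE.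
case: existsP => [[v /andP[vs vi]]|H] /=.
  have : v \in [set u] by rewrite -Eu !inE vs vi orbT.
  by rewrite inE => /eqP <-; move/eqP: vi => ->; lia.
case/orP: ui => /eqP ui; first by lia.
by case: H; exists u; rewrite us ui eqxx.
Qed.

Lemma card_box n (h : (2 * d <= n)%N) : #|[pred s : dsub n d | inBox s]| = (2 ^ d)%N.
Proof.
have <- : #|{ffun 'I_d -> bool}| = (2 ^ d)%N by rewrite card_ffun card_bool card_ord.
rewrite -(card_codom (@boxset_inj n h)); apply: eq_card => s.
rewrite inE; apply/idP/codomP => [/(inBoxE h)|[om ->]] //; exact: inBox_boxset.
Qed.

End Box.

(** * Decoupling one entry of a spreadable array *)

Section Mix.
Variables (R : realFieldType) (V : finType) (v0 : V).

Fixpoint mix d (b : nat -> bool) : pw V d -> pw V d -> pw V d :=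
  if d is d'.+1 return pw V d -> pw V d -> pw V d then
    fun u u' => (if b 0%N then u'.1 else u.1, @mix d' (fun i => b i.+1) u.2 u'.2)
  else fun u _ => u.

Lemma pget_mix d b (u u' : pw V d) i :
  (i < d)%N -> pget v0 (mix b u u') i = if b i then pget v0 u' i else pget v0 u i.
Proof. by elim: d b u u' i => // d IH b u u' [|i] //= id; rewrite IH. Qed.

(** A product of numbers in [0, 1] is at most each of its factors, and the points [mix b u u'] are
    the corners over which [prodbox] multiplies. *)
Lemma prodbox_le_mix d (g : pw V d -> R) b u u' :
  (forall z, 0 <= g z <= 1) -> prodbox g u u' <= g (mix b u u').
Proof.
elim: d g b u u' => [|d IH] g b u u' g01 /=; first by case: u.
have g2 z : 0 <= g (u.1, z) * g (u'.1, z) <= 1.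
  have /andP[a0 a1] := g01 (u.1, z); have /andP[b0 b1] := g01 (u'.1, z).
  by rewrite mulr_ge0 //= mulr_ile1.
apply: le_trans (IH _ (fun i => b i.+1) _ _ g2) _.
have /andP[a0 a1] := g01 (u.1, mix (fun i => b i.+1) u.2 u'.2).
have /andP[b0 b1] := g01 (u'.1, mix (fun i => b i.+1) u.2 u'.2).
by case: (b 0%N); [exact: ler_piMl|exact: ler_piMr].
Qed.

(** A coordinate shared by [u] and [u'] makes the box degenerate; this count majorizes the indicator
    of that event. *)
Definition collisions d (u u' : pw V d) : R :=
  \sum_(i < d) (pget v0 u i == pget v0 u' i)%:R.

Lemma Ex_collisions (al : V -> R) d : pmf al ->
  Ex (pw_weight al (d:=d)) (fun u => Ex (pw_weight al (d:=d)) (collisions u))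
  = d%:R * Ex al (fun a => Ex al (fun b => (a == b)%:R)).
Proof.
move=> pal; elim: d => [|d IH].
  rewrite mul0r; rewrite (@eq_Ex _ _ _ _ (fun=> 0)) ?Ex_cst //; first exact: pw_weight_pmf.
  move=> u; rewrite (@eq_Ex _ _ _ _ (fun=> 0)) ?Ex_cst //; first exact: pw_weight_pmf.
  by move=> u'; rewrite /collisions big_ord0.
have pwt := pw_weight_pmf pal d.
rewrite Ex_pair.
transitivity (Ex al (fun a => Ex (pw_weight al (d:=d)) (fun u =>
   Ex al (fun a' => (a == a')%:R) + Ex (pw_weight al (d:=d)) (collisions u)))).
  apply: eq_Ex => a; apply: eq_Ex => u; rewrite Ex_pair.
  have E a' u' : collisions ((a, u) : pw V d.+1) (a', u') = (a == a')%:R + collisions u u'.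
    by rewrite /collisions big_ord_recl /=; congr (_ + _); apply: eq_bigr.
  under eq_Ex => a' do under eq_Ex => u' do rewrite E.
  under eq_Ex => a' do rewrite ExD (Ex_cst _ pwt).
  by rewrite ExD (Ex_cst _ pal).
under eq_Ex => a do rewrite ExD (Ex_cst _ pwt).
by rewrite ExD (Ex_cst _ pal) IH -natr1; ring.
Qed.

End Mix.

Section EnumSet.
Variables (n : nat) (v0 : 'I_n).

Lemma nth_enum_ltn (A : {set 'I_n}) i j :
  (i < j)%N -> (j < #|A|)%N -> (nth v0 (enum A) i < nth v0 (enum A) j)%N.
Proof.
move=> ij jA; have jsz : (j < size (enum A))%N by rewrite -cardE.
have srt : sorted ltn (map val (enum A)).
  have -> : enum A = [seq x <- enum 'I_n | x \in A] by rewrite enumT.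
  have : sorted (relpre val ltn) (enum 'I_n) by rewrite -sorted_map val_enum_ord iota_ltn_sorted.
  by move=> s; rewrite sorted_map; apply: sorted_filter s => a b c; exact: ltn_trans.
have /(_ i j) := sorted_ltn_nth ltn_trans 0%N srt.
by rewrite !inE !size_map !(nth_map v0) //; [apply; rewrite // (ltn_trans ij)|exact: ltn_trans ij _].
Qed.

Lemma imset_nth_enum (A : {set 'I_n}) d : #|A| = d -> A = [set nth v0 (enum A) i | i : 'I_d].
Proof.
move=> Ad; apply/setP => v; apply/idP/imsetP => [vA|[i _ ->]].
  have vi : (index v (enum A) < d)%N by rewrite -Ad cardE index_mem mem_enum.
  by exists (Ordinal vi) => //=; rewrite nth_index ?mem_enum.
by rewrite -mem_enum mem_nth // -cardE Ad.
Qed.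

End EnumSet.

Lemma norm_prod_subX (R : realFieldType) (I : eqType) (r : seq I) (F : I -> R) b c :
  0 <= b <= 1 -> (forall i, 0 <= F i <= 1) -> (forall i, `|F i - b| <= c) ->
  `|\prod_(i <- r) F i - b ^+ size r| <= (size r)%:R * c.
Proof.
move=> /andP[b0 b1] F01 Fc; elim: r => [|i r IH] /=; first by rewrite big_nil subrr normr0 mul0r.
rewrite big_cons exprS.
have -> : F i * \prod_(j <- r) F j - b * b ^+ size r =
  (F i - b) * \prod_(j <- r) F j + b * (\prod_(j <- r) F j - b ^+ size r) by ring.
have /andP[p0 p1] : 0 <= \prod_(j <- r) F j <= 1.
  elim/big_rec: _ => [|j z _ /andP[z0 z1]]; first by rewrite ler01 lexx.
  by have /andP[? ?] := F01 j; rewrite mulr_ge0 //= mulr_ile1.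
apply: le_trans (ler_normD _ _) _; rewrite !normrM (ger0_norm p0) (ger0_norm b0) -natr1 mulrDl mul1r addrC.
apply: lerD; first by apply: le_trans IH; exact: ler_piMl.
by apply: le_trans (Fc i); exact: ler_piMr.
Qed.

Section OneSite.
Variables (R : realType) (T : finType) (d l n N' : nat) (P : config T n d -> R) (eta : R).
Hypotheses (d0 : (0 < d)%N) (ln : (l * N'.+1 <= n)%N) (dln : (2 * d <= n)%N).
Hypotheses (Ppmf : is_pmf P) (Psp : spreadable P eta) (eta0 : 0 <= eta).

Notation V := 'I_N'.+1.
Definition unif (_ : V) : R := N'.+1%:R^-1.

Lemma unif_pmf : pmf unif.
Proof.
split=> [i|]; first by rewrite invr_ge0.
by rewrite sumr_const card_ord -[LHS]mulr_natl mulfV // pnatr_eq0.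
Qed.

Lemma unif_collision : Ex unif (fun a => Ex unif (fun b => (a == b)%:R)) = N'.+1%:R^-1.
Proof.
rewrite -[RHS](Ex_cst _ unif_pmf); apply: eq_Ex => a.
rewrite /Ex (bigD1 a) //= eqxx mulr1 big1 ?addr0 // => b ba.
by rewrite eq_sym (negbTE ba) mulr0.
Qed.

Lemma emb_subproof (g : 'I_l -> V) (v : 'I_l) : (v * N'.+1 + g v < n)%N.
Proof.
apply: leq_trans ln; have : (v.+1 * N'.+1 <= l * N'.+1)%N by rewrite leq_mul2r ltn_ord orbT.
by apply: leq_trans; rewrite mulSn addnC ltn_add2r.
Qed.

(** [[0, n)] contains [l] consecutive intervals of length [N' + 1], and [g v] is a position inside
    the [v]-th one; every choice of positions gives an increasing map. *)
Definition emb (g : 'I_l -> V) (v : 'I_l) : 'I_n := Ordinal (emb_subproof g v).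

Lemma emb_lt (g g' : 'I_l -> V) (v v' : 'I_l) : (v < v')%N -> (emb g v < emb g' v')%N.
Proof.
move=> vv'; apply: (@leq_trans (v.+1 * N'.+1)).
  by rewrite /= mulSn addnC ltn_add2r.
by apply: leq_trans (leq_addr _ _); rewrite leq_mul2r vv' orbT.
Qed.

Lemma emb_incr g : strictly_increasing (emb g).
Proof. by move=> a b; exact: emb_lt. Qed.

(** Only the vertices of [s0] move, each with its own coordinate of [u]; the other points stay at
    the start of their intervals. *)
Definition shift (s0 : dsub l d) (u : pw V d) (v : 'I_l) : V :=
  if v \in val s0 then pget ord0 u (index v (enum (val s0))) else ord0.

Definition emb_inj g := increasing_inj (@emb_incr g).

Definition samp (s0 : dsub l d) (u : pw V d) (x : config T n d) : config T l d :=
  pull (@emb_inj (shift s0 u)) x.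

Lemma ProbE (A : pred (config T n d)) : Prob P A = Ex P (fun x => (A x)%:R).
Proof. by rewrite /Prob /Ex big_mkcond; apply: eq_bigr => x _; case: (A x); rewrite ?mulr1 ?mulr0. Qed.

Lemma norm_bool01 (b : bool) : `|b%:R : R| <= 1.
Proof. by case: b; rewrite ?normr1 ?normr0. Qed.

Lemma marginal_close a (s s' : dsub n d) :
  `|Prob P (fun x => x s == a) - Prob P (fun x => x s' == a)| <= 2 * eta.
Proof.
have n0 : (0 < n)%N by apply: leq_trans dln; rewrite muln_gt0.
pose v0 : 'I_n := Ordinal n0.
pose e (t : dsub n d) (i : 'I_d) : 'I_n := nth v0 (enum (val t)) i.
have ei t : strictly_increasing (e t).
  by move=> i j ij; apply: nth_enum_ltn => //; rewrite (eqP (valP t)).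
have cT : #|[set: 'I_d]| == d by rewrite cardsT card_ord.
pose full : dsub d d := exist _ [set: 'I_d] cT.
have := spreadable_Ex (increasing_inj (ei s)) (increasing_inj (ei s')) (G := fun y => (y full == a)%:R)
  Psp (leqnn d) (ei s) (ei s') (fun y => norm_bool01 _).
have E t : Ex P (fun x => (pull (increasing_inj (ei t)) x full == a)%:R) = Prob P (fun x => x t == a).
  rewrite ProbE; apply: eq_Ex => x; rewrite (pullE _ _ (s := t)) //=.
  apply/setP => v; rewrite {1}(imset_nth_enum v0 (eqP (valP t))).
  by apply/idP/idP => /imsetP[i _ ->]; apply/imsetP; exists i; rewrite ?inE.
by rewrite !E.
Qed.

Lemma Prob01 (A : pred (config T n d)) : 0 <= Prob P A <= 1.
Proof.
rewrite ProbE Ex_ge0 //= -[leRHS](Ex_cst (w := P)) // ler_Ex // => x.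
by case: (A x).
Qed.

Definition hit a (s0 : dsub l d) (x : config T n d) (u : pw V d) : R := (samp s0 u x s0 == a)%:R.

Lemma mean_hit_close a s0 s :
  `|Prob P (fun x => x s == a) - mean unif P (hit a s0)| <= 2 * eta.
Proof.
have pwt := pw_weight_pmf unif_pmf d.
rewrite /mean Ex_swap -(Ex_cst (Prob P (fun x => x s == a)) pwt) -ExB.
apply: ler_norm_Ex => // u.
have -> : Ex P (fun x => hit a s0 x u) = Prob P (fun x => x (imd (@emb_inj (shift s0 u)) s0) == a).
  by rewrite ProbE; apply: eq_Ex => x; rewrite /hit /samp ffunE.
exact: marginal_close.
Qed.

(** Each [s] in [D] misses a vertex of [s0], so its entry ignores the coordinate moving that vertex;
    test functions are closed under products. *)
Lemma test_hits (s0 : dsub l d) (D : seq (dsub l d)) c : s0 \notin D ->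
  test (fun (x : config T n d) (u : pw V d) => \prod_(s <- D) (samp s0 u x s == c s)%:R : R).
Proof.
elim: D => [|s D IH]; first by move=> _; apply: (eq_test _ (@test1 R V d _)) => x u; rewrite big_nil.
rewrite inE negb_or => /andP[s0s /IH{}IH].
apply: (@eq_test R V d _ (fun x u => (samp s0 u x s == c s)%:R * \prod_(t <- D) (samp s0 u x t == c t)%:R)).
  by move=> x u; rewrite big_cons.
apply: testM IH; have [v vs0 vs] := exists_missing s0s.
apply: (@test_indep R V ord0 d _ _ (index v (enum (val s0)))).
- by rewrite -[X in (_ < X)%N](eqP (valP s0)) cardE index_mem mem_enum.
- by move=> x u; exact: norm_bool01.
move=> x u u' uu'; congr (_ == _)%:R; rewrite /samp !ffunE; congr (x _); apply: val_inj => /=.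
apply: eq_in_imset => w ws; apply: val_inj => /=; congr (_ + _)%N; congr val.
rewrite /shift; case: ifP => // ws0; apply: uu'; apply: contraNneq vs => E.
have : w \in enum (val s0) by rewrite mem_enum.
by move/(nth_index w); rewrite E nth_index ?mem_enum // => ->.
Qed.

(* [sel false] and [sel true] are the smaller and the larger of the two [i]-th coordinates. *)
Definition sel (b : bool) (u u' : pw V d) (i : nat) : V :=
  if b (+) (pget ord0 u' i < pget ord0 u i)%N then pget ord0 u' i else pget ord0 u i.

Lemma sel_lt u u' i : pget ord0 u i != pget ord0 u' i -> (sel false u u' i < sel true u u' i)%N.
Proof.
rewrite /sel -val_eqE /= => ne.
by case: (ltnP (pget ord0 u' i) (pget ord0 u i)) => h /=; lia.
Qed.

(** Sorting the two positions inside each interval makes the map increasing as long as no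
    coordinates collide; it carries the box of [[0, 2 d)] to the corners spanned by [u] and [u']. *)
Definition boxemb (v0 : 'I_l) (s0 : dsub l d) (u u' : pw V d) (w : 'I_(2 * d)) : 'I_n :=
  emb (fun _ => sel (odd w) u u' w./2) (nth v0 (enum (val s0)) w./2).

Lemma boxemb_incr v0 s0 u u' :
  (forall i, (i < d)%N -> pget ord0 u i != pget ord0 u' i) -> strictly_increasing (boxemb v0 s0 u u').
Proof.
move=> ne w w' ww'; have : (w./2 <= w'./2)%N by apply: half_leq; exact: ltnW.
have w'd : (w'./2 < d)%N by have := ltn_ord w'; lia.
rewrite leq_eqVlt => /orP[/eqP E|lt]; last first.
  by apply: emb_lt; apply: nth_enum_ltn => //; rewrite (eqP (valP s0)).
have [ow ow'] : odd w = false /\ odd w' = true by split; lia.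
by rewrite /= ow ow' E ltn_add2l sel_lt ?ne.
Qed.

Lemma boxemb_boxset v0 s0 u u' (om : {ffun 'I_d -> bool}) :
  exists b, boxemb v0 s0 u u' @: val (boxset (leqnn (2 * d)) om) = emb (shift s0 (mix b u u')) @: val s0.
Proof.
(* [sel] refers to the order of the two coordinates, [mix] to their origin; the exclusive or
   translates one into the other. *)
pose b i := (if insub i is Some k then om k else false) (+) (pget ord0 u' i < pget ord0 u i)%N.
exists b; rewrite (imset_nth_enum v0 (eqP (valP s0))) /= -!imset_comp.
apply: eq_imset => i /=; apply: val_inj => /=.
have hi : ((2 * i + om i)%N)./2 = i by case: (om i) => /=; lia.
have oi : odd (2 * i + om i) = om i by case: (om i) => /=; lia.
have isz : (i < size (enum (val s0)))%N by rewrite -cardE (eqP (valP s0)).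
rewrite hi oi; congr (_ + _)%N; congr val; rewrite /shift -mem_enum mem_nth // index_uniq ?enum_uniq //.
by rewrite pget_mix // /b valK /sel.
Qed.

Definition box_event (a : T) (x : config T n d) : bool :=
  [forall s : dsub n d, inBox s ==> (x s == a)].

(** Sources of the error: [d / (N' + 1)] is the mean number of collisions, [2 * eta] moves a
    nondegenerate box to the standard one, [theta] is the hypothesis, and the last term replaces
    each of the [2 ^ d] marginals by their average. *)
Lemma box_le a (s0 : dsub l d) theta :
  `|Prob P (box_event a) - \prod_(s : dsub n d | inBox s) Prob P (fun x => x s == a)| <= theta ->
  box unif P (hit a s0) <= mean unif P (hit a s0) ^+ (2 ^ d)%N
     + (d%:R / N'.+1%:R + 2 * eta + theta + (2 ^ d)%:R * (2 * eta)).
Proof.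
move=> Hth; have pwt := pw_weight_pmf unif_pmf d.
set de := mean unif P (hit a s0).
have de01 : 0 <= de <= 1.
  apply/andP; split; first by apply: mean_ge0 => //; exact: unif_pmf.
  have := @ler_norm_Ex _ _ P (fun x => Ex (pw_weight unif (d:=d)) (hit a s0 x)) 1 Ppmf.
    rewrite -/de => H; apply: le_trans (ler_norm _) (H _) => x; apply: ler_norm_Ex => // u; exact: norm_bool01.
have Hprod : \prod_(s : dsub n d | inBox s) Prob P (fun x => x s == a) <= de ^+ (2 ^ d)%N + (2 ^ d)%:R * (2 * eta).
  rewrite -big_filter.
  set r := [seq _ <- _ | _]; have sz : size r = (2 ^ d)%N.
    by rewrite -(card_box dln) -sum1_card -sum1_size big_filter; apply: eq_bigl.
  have := norm_prod_subX r de01 (fun s => Prob01 _) (fun s => mean_hit_close a s0 s).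
  by rewrite sz => /ler_normlP[_]; rewrite lerBlDl addrC.
have [v0 _] : exists v0, v0 \in val s0 by apply/card_gt0P; rewrite (eqP (valP s0)).
set q := Prob P (box_event a) in Hth *.
have q01 : 0 <= q <= 1 := Prob01 _.
have step u u' : Ex P (fun x => prodbox (hit a s0 x) u u') <= q + 2 * eta + collisions R ord0 u u'.
  have h01 x z : 0 <= hit a s0 x z <= 1 by rewrite /hit; case: (_ == _); rewrite ?lexx ?ler01.
  have coll0 : 0 <= collisions R ord0 u u' by apply: sumr_ge0.
  have [/existsP[i /eqP Ei]|/existsPn ne] := boolP [exists i : 'I_d, pget ord0 u i == pget ord0 u' i].
    apply: (@le_trans _ _ 1).
      rewrite -[leRHS](Ex_cst (w := P)) // ler_Ex // => x.
      apply: le_trans (prodbox_le_mix (fun=> false) _ _ (h01 x)) _.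
      by have /andP[] := h01 x (mix (fun=> false) u u').
    have : 1 <= collisions R ord0 u u'.
      by rewrite /collisions (bigD1 i) //= Ei eqxx lerDl sumr_ge0.
    by move/le_trans; apply; rewrite lerDr addr_ge0 ?mulr_ge0 //; case/andP: q01.
  have ne' i : (i < d)%N -> pget ord0 u i != pget ord0 u' i by move=> id; exact: (ne (Ordinal id)).
  have inc := boxemb_incr v0 s0 ne'.
  have winc : strictly_increasing (widen_ord dln) by [].
  pose G (y : config T (2 * d) d) : R := [forall s : dsub (2 * d) d, inBox s ==> (y s == a)]%:R.
  have d2 : (d <= 2 * d)%N by lia.
  have := spreadable_Ex (increasing_inj inc) (increasing_inj winc) (G := G)
     Psp d2 inc winc (fun y => norm_bool01 _).
  move/ler_normlP => [_]; rewrite lerBlDl => HG.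
  have HGq : Ex P (fun x => G (pull (increasing_inj winc) x)) <= q.
    rewrite /q ProbE; apply: ler_Ex => // x; rewrite /G.
    case: forallP => [H|_] //=; rewrite (_ : box_event a x) //.
    apply/forallP => s; apply/implyP => /(inBoxE dln)[om ->].
    have := H (boxset (leqnn (2 * d)) om); rewrite inBox_boxset /= (pullE _ _ (s := boxset dln om)) //=.
    by rewrite -imset_comp; apply: eq_imset => i; apply: val_inj.
  (* If some corner carries a value other than [a], the corresponding factor of the product is 0. *)
  have HGb : Ex P (fun x => prodbox (hit a s0 x) u u') <= Ex P (fun x => G (pull (increasing_inj inc) x)).
    apply: ler_Ex => // x; rewrite /G.
    case: (boolP [forall s : dsub (2 * d) d, inBox s ==> (pull (increasing_inj inc) x s == a)]) => [_|/forallPn[t]].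
      apply: le_trans (prodbox_le_mix (fun=> false) _ _ (h01 x)) _.
      by have /andP[] := h01 x (mix (fun=> false) u u').
    rewrite negb_imply => /andP[/(inBoxE (leqnn (2 * d)))[om ->] Hne].
    have [b Hb] := boxemb_boxset v0 s0 u u' om.
    apply: le_trans (prodbox_le_mix b _ _ (h01 x)) _.
    rewrite /hit /samp ffunE.
    move: Hne; rewrite (pullE _ _ (s := imd (@emb_inj (shift s0 (mix b u u'))) s0)) //=.
    by move/negbTE => ->.
  by lra.
have : box unif P (hit a s0) <= q + 2 * eta + d%:R / N'.+1%:R.
  rewrite /box Ex_swap.
  apply: (@le_trans _ _ (Ex (pw_weight unif (d:=d)) (fun u => Ex (pw_weight unif (d:=d)) (fun u' => q + 2 * eta + collisions R ord0 u u')))).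
    apply: ler_Ex => // u; rewrite Ex_swap; apply: ler_Ex => // u'; exact: step.
  under eq_Ex => u do rewrite ExD Ex_cst //.
  by rewrite ExD Ex_cst // Ex_collisions ?unif_collision //; exact: unif_pmf.
move: Hth => /ler_normlP[_]; rewrite lerBlDl => Hth; move: Hth Hprod.
move: (box _ _ _) (\prod_(_ | _) _) (_ ^+ _) ((2 ^ d)%:R * _) (d%:R / _) => b pr de2 e2 dn Hth Hprod Hbox.
by lra.
Qed.

(** Averaging over the shifts costs [2 * eta], replacing the marginal by its average another
    [2 * eta], and [decoupling] gives [d * r], the product over [D] being a test function. *)
Lemma one_site a (s0 : dsub l d) (st : dsub n d) (D : seq (dsub l d)) c g r theta :
  s0 \notin D -> 0 <= r -> (d <= l)%N ->
  `|Prob P (box_event a) - \prod_(s : dsub n d | inBox s) Prob P (fun x => x s == a)| <= theta ->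
  d%:R / N'.+1%:R + 2 * eta + theta + (2 ^ d)%:R * (2 * eta) <= r ^+ (2 ^ d)%N ->
  strictly_increasing g -> forall h : injective g,
  `|Ex P (fun x => ((pull h x s0 == a)%:R - Prob P (fun x => x st == a))
            * \prod_(s <- D) (pull h x s == c s)%:R)| <= 4 * eta + d%:R * r.
Proof.
move=> s0D r0 dl Hth Hr gi h; have pwt := pw_weight_pmf unif_pmf d.
set pi := Prob P (fun x => x st == a).
set de := mean unif P (hit a s0).
have pide : `|pi - de| <= 2 * eta by exact: mean_hit_close.
have pi01 : 0 <= pi <= 1 := Prob01 _.
pose Psi (y : config T l d) : R := \prod_(s <- D) (y s == c s)%:R.
have Psi01 y : 0 <= Psi y <= 1.
  rewrite /Psi; elim/big_rec: _ => [|j z _ /andP[z0 z1]]; first by rewrite ler01 lexx.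
  by case: (_ == _); rewrite ?mul1r ?mul0r ?z0 ?lexx ?ler01.
pose G (y : config T l d) : R := ((y s0 == a)%:R - pi) * Psi y.
have G1 y : `|G y| <= 1.
  rewrite /G normrM mulr_ile1 // ler_norml; have /andP[? ?] := Psi01 y; move/andP: pi01 => [? ?];
  by case: (y s0 == a); rewrite /=; apply/andP; split; lra.
rewrite -/(Ex P (fun x => G (pull h x))).
have close u : `|Ex P (fun x => G (pull h x)) - Ex P (fun x => G (samp s0 u x))| <= 2 * eta.
  by apply: spreadable_Ex => //; exact: emb_incr.
have closeM : `|Ex P (fun x => G (pull h x)) - mean unif P (fun x u => G (samp s0 u x))| <= 2 * eta.
  rewrite /mean Ex_swap -(Ex_cst (Ex P (fun x => G (pull h x))) pwt) -ExB.
  exact: ler_norm_Ex.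
have dec : `|mean unif P (fun x u => (hit a s0 x u - de) * Psi (samp s0 u x))| <= d%:R * r.
  apply: decoupling => //; first exact: unif_pmf.
  - exact: test_hits.
  by apply: le_trans (box_le s0 Hth) _; rewrite lerD2l.
have split : mean unif P (fun x u => G (samp s0 u x)) =
    mean unif P (fun x u => (hit a s0 x u - de) * Psi (samp s0 u x))
    - (pi - de) * mean unif P (fun x u => Psi (samp s0 u x)).
  rewrite /mean -ExZ -ExB; apply: eq_Ex => x; rewrite -ExZ -ExB; apply: eq_Ex => u.
  by rewrite /G /hit; ring.
have M1 : `|(pi - de) * mean unif P (fun x u => Psi (samp s0 u x))| <= 2 * eta.
  rewrite normrM; apply: le_trans (ler_piMr _ _) pide => //.
  apply: ler_norm_Ex => // x; apply: ler_norm_Ex => // u.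
  by have /andP[? ?] := Psi01 (samp s0 u x); rewrite ger0_norm.
move: closeM; rewrite split; move: dec M1; rewrite !ler_norml.
by move=> /andP[? ?] /andP[? ?] /andP[? ?]; apply/andP; split; lra.
Qed.

End OneSite.

(** * Approximation by independent entries *)

Section Telescoping.
Variables (R : realFieldType) (O T : finType) (w : O -> R) (pi : T -> R).
Hypotheses (w_pmf : pmf w) (pi_pmf : pmf pi).

Lemma pmf_le1 a : pi a <= 1.
Proof. by case: pi_pmf => p0 <-; rewrite (bigD1 a) //= lerDl sumr_ge0. Qed.

(** The centered indicators of all values sum to 0, so that of the exceptional value is minus the
    sum of the [#|T| - 1] others. *)
Lemma missing_value (X : O -> T) (Psi : O -> R) (S : {set T}) a g :
  #|S| = (#|T| - 1)%N -> a \notin S ->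
  (forall b, b \in S -> `|Ex w (fun x => ((X x == b)%:R - pi b) * Psi x)| <= g) ->
  `|Ex w (fun x => ((X x == a)%:R - pi a) * Psi x)| <= (#|T| - 1)%:R * g.
Proof.
move=> cS aS HS.
have S_C : S = [set~ a].
  apply/eqP; rewrite eqEcard cardsC1 cS subn1 leqnn andbT; apply/fintype.subsetP => b bS.
  by rewrite !inE; apply: contraNneq aS => <-.
have E : Ex w (fun x => ((X x == a)%:R - pi a) * Psi x)
       = - \sum_(b in S) Ex w (fun x => ((X x == b)%:R - pi b) * Psi x).
  rewrite /Ex exchange_big /= -sumrN; apply: eq_bigr => x _.
  rewrite -mulr_sumr -mulrN; congr (_ * _); rewrite -mulr_suml -mulNr; congr (_ * _).
  apply/eqP; rewrite -addr_eq0; apply/eqP.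
  have -> : \sum_(b in S) ((X x == b)%:R - pi b) = \sum_(b | b != a) ((X x == b)%:R - pi b).
    by apply: eq_bigl => b; rewrite S_C !inE.
  rewrite -(bigD1 a (P := predT) (F := fun b => (X x == b)%:R - pi b)) //= sumrB (proj2 pi_pmf).
  rewrite (bigD1 (X x)) //= eqxx big1 ?addr0 ?subrr // => b.
  by rewrite eq_sym => /negbTE ->.
rewrite E normrN; apply: le_trans (ler_norm_sum _ _ _) _.
by rewrite -cS -sum1_card natr_sum mulr_suml; apply: ler_sum => b bS; rewrite mul1r HS.
Qed.

Variables (I : finType) (Z : O -> {ffun I -> T}) (g : R).
Hypothesis Hg : forall a s (D : seq I) c, s \notin D ->
  `|Ex w (fun x => ((Z x s == a)%:R - pi a) * \prod_(t <- D) (Z x t == c t)%:R)| <= g.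

(** Entries are made independent one at a time, each at cost [g]; the factors [pi (y s) <= 1] split
    off do not amplify the error. *)
Lemma iid_approx_seq (y : {ffun I -> T}) (D : seq I) : uniq D ->
  `|Ex w (fun x => \prod_(t <- D) (Z x t == y t)%:R) - \prod_(t <- D) pi (y t)| <= (size D)%:R * g.
Proof.
elim: D => [|s D IH] /=.
  by rewrite big_nil mul0r (@eq_Ex _ _ _ _ (fun=> 1)) ?Ex_cst ?subrr ?normr0 // => x; rewrite big_nil.
move=> /andP[sD uD]; rewrite big_cons.
have -> : Ex w (fun x => \prod_(t <- s :: D) (Z x t == y t)%:R) =
    Ex w (fun x => ((Z x s == y s)%:R - pi (y s)) * \prod_(t <- D) (Z x t == y t)%:R)
    + pi (y s) * Ex w (fun x => \prod_(t <- D) (Z x t == y t)%:R).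
  by rewrite -ExZ -ExD; apply: eq_Ex => x; rewrite big_cons -mulrDl subrK.
rewrite -addrA -mulrBr -natr1 mulrDl mul1r addrC.
apply: le_trans (ler_normD _ _) _; apply: lerD; last exact: Hg.
rewrite normrM ger0_norm; last by case: pi_pmf.
by apply: le_trans (IH uD); rewrite ler_piMl // pmf_le1.
Qed.

Definition iid (y : {ffun I -> T}) : R := \prod_i pi (y i).

Lemma iid_approx :
  \sum_y `|Ex w (fun x => (Z x == y)%:R) - iid y| <= (#|T| ^ #|I| * #|I|)%:R * g.
Proof.
apply: (@le_trans _ _ (\sum_(y : {ffun I -> T}) #|I|%:R * g)); last first.
  by rewrite sumr_const card_ffun natrM -mulrA [leRHS]mulr_natl.
apply: ler_sum => y _; have := iid_approx_seq y (enum_uniq I).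
rewrite -cardE /iid !big_enum /=; congr (`|_ - _| <= _); apply: eq_Ex => x.
rewrite big_enum /=; case: eqP => [->|/eqP ne]; first by rewrite big1 // => i _; rewrite eqxx.
have [i Hi] : exists i, Z x i != y i.
  by apply/existsP; apply: contraNT ne => /existsPn H; apply/eqP/ffunP => i; apply/eqP; have := H i; rewrite negbK.
by rewrite (bigD1 i) //= (negbTE Hi) mul0r.
Qed.

Lemma iid_pmf : pmf iid.
Proof.
split=> [y|]; first by apply: prodr_ge0 => i _; case: pi_pmf.
by rewrite /iid -(bigA_distr_bigA (fun _ a => pi a)) /= big1 // => i _; case: pi_pmf.
Qed.

End Telescoping.

(** Both laws have mass 1, so [G] may be centered at [s / 2], which halves the trivial constant
    [s]. *)
Lemma Ex_le_tv (R : realFieldType) (I : finType) (mu nu G : I -> R) s :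
  pmf mu -> pmf nu -> (forall i, 0 <= G i <= s) ->
  Ex mu G <= Ex nu G + s / 2 * \sum_i `|mu i - nu i|.
Proof.
move=> [mu0 mu1] [nu0 nu1] G01; rewrite -lerBlDl.
have -> : Ex mu G - Ex nu G = \sum_i (mu i - nu i) * (G i - s / 2).
  under [RHS]eq_bigr => i _ do rewrite mulrBr.
  rewrite sumrB -mulr_suml !sumrB mu1 nu1 subrr mul0r subr0 /Ex -sumrB.
  by apply: eq_bigr => i _; rewrite mulrBl.
apply: le_trans (ler_norm _) _; apply: le_trans (ler_norm_sum _ _ _) _.
rewrite mulr_sumr; apply: ler_sum => i _; rewrite normrM mulrC ler_wpM2r //.
by rewrite ler_norml; have /andP[? ?] := G01 i; apply/andP; split; lra.
Qed.

Section Independence.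
Variables (R : realFieldType) (T I : finType) (pi : T -> R).
Hypothesis pi_pmf : pmf pi.
Notation nu := (@iid R T pi I).

Definition depends_on (A : pred I) (F : {ffun I -> T} -> R) :=
  forall y z : {ffun I -> T}, (forall i, A i -> y i = z i) -> F y = F z.

Definition splice (A : pred I) (y z : {ffun I -> T}) : {ffun I -> T} :=
  [ffun i => if A i then y i else z i].

(* Exchanging the coordinates outside [A] preserves the law of two independent copies. *)
Lemma Ex_iidM (A : pred I) (F G : {ffun I -> T} -> R) :
  depends_on A F -> depends_on (predC A) G ->
  Ex nu (fun y => F y * G y) = Ex nu F * Ex nu G.
Proof.
move=> FA GA; have nu_pmf := iid_pmf pi_pmf I.
transitivity (Ex (pairw nu nu) (fun p => F p.1 * G p.1)).
  by rewrite Ex_pair; apply: eq_Ex => y; rewrite /= Ex_cst.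
transitivity (Ex (pairw nu nu) (fun p => F p.1 * G p.2)); last first.
  by rewrite Ex_pair -ExZr; apply: eq_Ex => y; rewrite /= ExZ.
pose sw (p : {ffun I -> T} * {ffun I -> T}) := (splice A p.1 p.2, splice A p.2 p.1).
have swK : involutive sw.
  by move=> [y z]; congr (_, _); apply/ffunP => i; rewrite !ffunE; case: (A i).
rewrite /Ex (reindex_inj (inv_inj swK)) /=; apply: eq_bigr => -[y z] _ /=.
congr (_ * (_ * _)).
- rewrite /pairw /iid -!big_split /=; apply: eq_bigr => i _; rewrite !ffunE.
  by case: (A i) => //; rewrite mulrC.
- by apply: FA => i Ai; rewrite ffunE Ai.
- by apply: GA => i /= /negbTE Ai; rewrite ffunE Ai.
Qed.

Lemma Ex_iid_prod (J : eqType) (r : seq J) (A : J -> pred I) (F : J -> {ffun I -> T} -> R) :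
  uniq r -> (forall j, depends_on (A j) (F j)) ->
  (forall i j j', A j i -> A j' i -> j = j') ->
  Ex nu (fun y => \prod_(j <- r) F j y) = \prod_(j <- r) Ex nu (F j).
Proof.
move=> ur FA disj; have nu_pmf := iid_pmf pi_pmf I.
elim: r ur => [|j r IH] /=.
  by rewrite big_nil (@eq_Ex _ _ _ _ (fun=> 1)) ?Ex_cst // => y; rewrite big_nil.
move=> /andP[jr ur]; rewrite big_cons -(IH ur).
rewrite -(@Ex_iidM (A j)) //; first by apply: eq_Ex => y; rewrite big_cons.
move=> y z yz; apply: eq_big_seq => j' j'r; apply: FA => i Ai; apply: yz => /=.
by apply: contraNN jr => Aji; rewrite (disj _ _ _ Aji Ai).
Qed.

End Independence.

(** * Moments of sums over disjoint blocks *)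

Section Hoeffding.
Import numFieldNormedType.Exports.
Variable R : realType.

Lemma le_at0_of_deriv_le0 (f f' : R -> R) (t : R) :
  (forall s : R, is_derive s 1 f (f' s)) -> (forall s, 0 <= s -> f' s <= 0) ->
  0 <= t -> f t <= f 0.
Proof.
move=> df f'0; rewrite le_eqVlt => /predU1P[<- //|t0].
have cf : {within `[0, t], continuous f}%classic.
  by apply: derivable_within_continuous => s _; have := df s; case.
have [c] := MVT t0 (fun s _ => df s) cf.
rewrite in_itv /= => /andP[c0 _] E; rewrite -subr_le0 E subr0.
by rewrite mulr_le0_ge0 ?f'0 // ltW.
Qed.

(* With [D] the moment generating function of the two-point law (times [expR s]) and [N = D'], the
   logarithmic derivative of the quotient of the two sides is [N / D - 1 - mu - s], which vanishes at
   [0] and has derivative [- ((N - D) / D) ^+ 2]. *)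
Lemma two_point_mgf (mu t : R) : -1 <= mu <= 1 -> 0 <= t ->
  (1 + mu) / 2 * expR t + (1 - mu) / 2 * expR (- t) <= expR (mu * t + t ^+ 2 / 2).
Proof.
move=> /andP[mu1 mu2] t0.
pose D (s : R) := (1 + mu) / 2 * expR (2 * s) + (1 - mu) / 2.
pose N (s : R) := (1 + mu) * expR (2 * s).
have D_gt0 s : 0 < D s.
  rewrite /D; have e0 := expR_gt0 (2 * s); have [->|mu_lt] := eqVneq mu 1.
    by rewrite subrr mul0r addr0 mulr_gt0.
  have : mu < 1 by rewrite lt_neqAle mu_lt.
  by move=> ?; apply: ltr_wpDl; [apply: mulr_ge0; [lra|exact: ltW]|lra].
have dD (s : R) : is_derive s 1 D (N s).
  by apply: is_derive_eq; rewrite /GRing.scale /= /N; field.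
have dN (s : R) : is_derive s 1 N (2 * N s).
  by apply: is_derive_eq; rewrite /GRing.scale /= /N; ring.
pose u (s : R) := N s * (D s)^-1 - ((1 + mu) + s).
have du (s : R) : is_derive s 1 u (- ((N s - D s) / D s) ^+ 2).
  have Dn0 : D s != 0 by rewrite gt_eqF.
  have dDV := is_deriveV Dn0 (dD s).
  by apply: is_derive_eq; rewrite /GRing.scale /=; field.
have u0 : u 0 = 0 by rewrite /u /N /D mulr0 expR0; field; lra.
have u_le0 s : 0 <= s -> u s <= 0.
  move=> s0; rewrite -u0; apply: (le_at0_of_deriv_le0 du) => // z _.
  by rewrite oppr_le0 sqr_ge0.
pose G (s : R) := ln (D s) - ((1 + mu) * s + s ^+ 2 / 2).
have dG (s : R) : is_derive s 1 G (u s).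
  have dln := is_derive1_comp (is_derive1_ln (D_gt0 s)) (dD s).
  by apply: is_derive_eq; rewrite /GRing.scale /= /u; field; rewrite gt_eqF.
have := le_at0_of_deriv_le0 dG u_le0 t0.
have -> : G 0 = 0.
  rewrite /G /D !mulr0 expR0 expr0n /= mul0r addr0 subr0.
  by rewrite (_ : _ + _ = 1) ?ln1 //; field.
rewrite /G subr_le0 -ler_expR lnK ?posrE // /D => H.
have -> : mu * t + t ^+ 2 / 2 = - t + ((1 + mu) * t + t ^+ 2 / 2) by ring.
rewrite expRD; apply: le_trans (ler_wpM2l (expR_ge0 (- t)) H).
rewrite mulrDr [X in _ <= X + _]mulrCA -expRD [X in _ <= _ + X]mulrC lerD2r.
by rewrite (_ : - t + 2 * t = t) //; ring.
Qed.

Lemma expR_chord (h t : R) : -1 <= h <= 1 ->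
  expR (h * t) <= (1 + h) / 2 * expR t + (1 - h) / 2 * expR (- t).
Proof.
move=> /andP[h1 h2].
have i0 : 0 <= (1 + h) / 2 by lra.
have i1 : (1 + h) / 2 <= 1 by lra.
have := convex_expR (Itv01 i0 i1) t (- t).
rewrite !convRE /= /unstable.onem.
have -> : (1 + h) / 2 * t + (1 - (1 + h) / 2) * - t = h * t by field.
by have -> : 1 - (1 + h) / 2 = (1 - h) / 2 by field.
Qed.

(** The chord bound is affine in [h i], so after averaging only the mean of [h] matters, and the
    two-point law on -1 and 1 with that mean is the extreme case. *)
Lemma hoeffding (I : finType) (w h : I -> R) (t : R) : pmf w -> (forall i, `|h i| <= 1) -> 0 <= t ->
  Ex w (fun i => expR (t * (h i - Ex w h))) <= expR (t ^+ 2 / 2).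
Proof.
move=> pw h1 t0; set mu := Ex w h.
have mu1 : -1 <= mu <= 1 by rewrite -ler_norml; exact: ler_norm_Ex.
have -> : Ex w (fun i => expR (t * (h i - mu))) = expR (- (mu * t)) * Ex w (fun i => expR (h i * t)).
  by rewrite -ExZ; apply: eq_Ex => i; rewrite -expRD; congr expR; ring.
have -> : t ^+ 2 / 2 = - (mu * t) + (mu * t + t ^+ 2 / 2) by ring.
rewrite expRD ler_wpM2l ?expR_ge0 //; apply: le_trans (two_point_mgf mu1 t0).
apply: (@le_trans _ _ (Ex w (fun i => (1 + h i) / 2 * expR t + (1 - h i) / 2 * expR (- t)))).
  by apply: ler_Ex => // i; apply: expR_chord; rewrite -ler_norml.
rewrite (@eq_Ex _ _ _ _ (fun i => (expR t + expR (- t)) / 2 + h i * ((expR t - expR (- t)) / 2))).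
  by rewrite ExD Ex_cst // ExZr -/mu le_eqVlt; apply/orP; left; apply/eqP; field.
by move=> i; field.
Qed.

End Hoeffding.

Section Moment.
Variables (R : realType) (T I : finType) (pi : T -> R) (L : nat) (A : 'I_L -> pred I).
Notation nu := (@iid R T pi I).
Hypothesis pi_pmf : pmf pi.
Hypothesis A_disj : forall i j j', A j i -> A j' i -> j = j'.

Definition centered_sum (H : 'I_L -> {ffun I -> T} -> R) y := \sum_j (H j y - Ex nu (H j)).

Lemma mgf_centered_sum (H : 'I_L -> {ffun I -> T} -> R) (lam : R) :
  (forall j, depends_on (A j) (H j)) -> (forall j y, `|H j y| <= 1) -> 0 <= lam ->
  Ex nu (fun y => expR (lam * centered_sum H y)) <= expR (L%:R * (lam ^+ 2 / 2)).
Proof.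
move=> HA H1 lam0; have nu_pmf := iid_pmf pi_pmf I.
rewrite (@eq_Ex _ _ _ _ (fun y => \prod_(j < L) expR (lam * (H j y - Ex nu (H j))))); last first.
  by move=> y; rewrite /centered_sum mulr_sumr expR_sum.
rewrite (@Ex_iid_prod _ _ _ _ pi_pmf _ _ A) ?index_enum_uniq //; last first.
  by move=> j y z yz; rewrite (HA j y z yz).
rewrite expRM_natl -[X in _ <= _ ^+ X](card_ord L) -prodr_const.
apply: ler_prod => j _; rewrite hoeffding // andbT.
by apply: Ex_ge0 => // y; exact: expR_ge0.
Qed.

Lemma centered_sumN (H : 'I_L -> {ffun I -> T} -> R) y :
  centered_sum (fun j y => - H j y) y = - centered_sum H y.
Proof.
rewrite /centered_sum -sumrN; apply: eq_bigr => j _.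
by rewrite (@eq_Ex _ _ _ _ (fun y => -1 * H j y)) ?ExZ => [|z]; rewrite ?mulN1r // opprB opprK addrC.
Qed.

(* Chernoff: [u ^ q <= exp (q (u - 1))], used with [lam = 2 / (t (p - 1))]. *)
Lemma moment_centered_sum (H : 'I_L -> {ffun I -> T} -> R) (p eps : R) :
  (forall j, depends_on (A j) (H j)) -> (forall j y, `|H j y| <= 1) ->
  1 < p -> p <= 2 -> 0 < eps -> 2 <= L%:R * (eps ^+ 4 * (p - 1)) ->
  Ex nu (fun y => (`|centered_sum H y| / (L%:R * eps ^+ 2)) `^ (p / (p - 1))) <= 2 * expR (- 1).
Proof.
move=> HA H1 p1 p2 eps0 HL; have nu_pmf := iid_pmf pi_pmf I.
have p10 : 0 < p - 1 by rewrite subr_gt0.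
have e40 : 0 < eps ^+ 4 * (p - 1) by rewrite mulr_gt0 ?exprn_gt0.
have L0 : 0 < L%:R :> R by rewrite -(pmulr_lgt0 _ e40); lra.
set t := L%:R * eps ^+ 2; have t0 : 0 < t by rewrite mulr_gt0 ?exprn_gt0.
set q := p / (p - 1); have q0 : 0 < q by rewrite divr_gt0 //; lra.
set lam := 2 / (t * (p - 1)); have lam0 : 0 < lam by rewrite divr_gt0 ?mulr_gt0.
set S := centered_sum H.
have pt y : (`|S y| / t) `^ q <= expR (- q) * (expR (lam * S y) + expR (lam * - S y)).
  (* Here [p <= 2] enters: [lam / q = (2 / p) / t]. *)
  have Sq : `|S y| / t <= lam * `|S y| / q.
    have -> : lam * `|S y| / q = lam / q * `|S y| by ring.
    rewrite mulrC; apply: ler_wpM2r => //.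
    rewrite /lam /q invf_div.
    have -> : 2 / (t * (p - 1)) * ((p - 1) / p) = t^-1 * (2 / p) by field; lra.
    apply: ler_peMr; first by rewrite invr_ge0 ltW.
    by rewrite ler_pdivlMr ?mul1r //; lra.
  have le_exp : `|S y| / t <= expR (lam * `|S y| / q - 1).
    by apply: le_trans Sq _; apply: le_trans (expR_ge1Dx _); lra.
  apply: (@le_trans _ _ (expR (lam * `|S y| / q - 1) `^ q)).
    by apply: (ge0_ler_powR (ltW q0)); rewrite // nnegrE ?expR_ge0 // mulr_ge0 // invr_ge0 ltW.
  rewrite -expRM; have -> : (lam * `|S y| / q - 1) * q = - q + lam * `|S y| by field; lra.
  rewrite expRD ler_wpM2l ?expR_ge0 //.
  by case: (ger0P (S y)) => _; rewrite ?lerDl ?lerDr ?expR_ge0.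
apply: (@le_trans _ _ (Ex nu (fun y => expR (- q) * (expR (lam * S y) + expR (lam * - S y))))).
  exact: ler_Ex.
rewrite ExZ ExD.
have m1 := mgf_centered_sum HA H1 (ltW lam0).
have m2 : Ex nu (fun y => expR (lam * - S y)) <= expR (L%:R * (lam ^+ 2 / 2)).
  have HA' j : depends_on (A j) (fun y => - H j y) by move=> y z yz; rewrite (HA j y z yz).
  have H1' j y : `|- H j y| <= 1 by rewrite normrN.
  have := mgf_centered_sum HA' H1' (ltW lam0).
  by under eq_Ex => y do rewrite centered_sumN.
apply: (@le_trans _ _ (expR (- q) * (2 * expR (L%:R * (lam ^+ 2 / 2))))).
  by rewrite ler_wpM2l ?expR_ge0 // mulrDl !mul1r lerD.
rewrite mulrCA -expRD ler_wpM2l // ler_expR.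
(* By [HL] the Hoeffding exponent is at most [1 / (p - 1)], while [q = 1 + 1 / (p - 1)]. *)
have -> : L%:R * (lam ^+ 2 / 2) = 2 / (L%:R * (eps ^+ 4 * (p - 1))) / (p - 1).
  by rewrite /lam /t; field; do ?[apply/andP; split]; rewrite ?gt_eqF ?exprn_gt0 //.
have -> : - q = - 1 - (p - 1)^-1 by rewrite /q; field; lra.
rewrite -addrA gerDl addrC subr_le0 ler_piMl ?invr_ge0 ?(ltW p10) //.
by rewrite ler_pdivrMr ?mul1r //; apply: lt_le_trans HL.
Qed.

End Moment.

(** * Numerical bounds *)

Section Budget.
Variable R : realType.

Lemma ln2_ge : 2^-1 <= ln 2 :> R.
Proof.
rewrite -ler_expR lnK ?posrE //.
have := @expR_ge1Dx R (- 2^-1); rewrite expRN => H.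
have e0 := expR_gt0 (2^-1 : R).
have := ler_wpM2l (ltW e0) H; rewrite mulfV ?gt_eqF //; lra.
Qed.

Lemma expR_double (b c x : R) : 0 <= c -> b <= c * c -> c <= expR x -> b <= expR (2 * x).
Proof. by move=> c0 bc cx; apply: le_trans bc _; rewrite mulr_natl mulr2n expRD ler_pM. Qed.

(** Six squarings of [65 / 64 <= exp (1 / 64)], rounded down. The value makes the moment bound
    [2 / e] at most [3 / 4]. *)
Lemma expR1_ge : 8 / 3 <= expR 1 :> R.
Proof.
have -> : 1 = 2 * (2 * (2 * (2 * (2 * (2 * 64^-1))))) :> R by field.
apply: (@expR_double _ (16384 / 10000)); [lra|lra|].
apply: (@expR_double _ (128 / 100)); [lra|lra|].
apply: (@expR_double _ (11314 / 10000)); [lra|lra|].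
apply: (@expR_double _ (10637 / 10000)); [lra|lra|].
apply: (@expR_double _ (10314 / 10000)); [lra|lra|].
apply: (@expR_double _ (65 / 64)); [lra|lra|].
by apply: le_trans (expR_ge1Dx _); lra.
Qed.

(** Meant for [w = 1 / eps ^ 2] and [y = 1 / (p - 1)], where [w ^ 2 y = x]. The reason is [ln 2 + ln
    w <= ln 2 + w - 1 <= w ^ 2 ln 2]. *)
Lemma two_powR_le (w y q : R) : 1 <= w -> 0 <= q -> q <= 2 * y ->
  (2 * w) `^ q <= expR (2 * (w ^+ 2 * y) * ln 2).
Proof.
move=> w1 q0 qy; have w0 : 0 < w by lra.
rewrite /powR gt_eqF ?mulr_gt0 // ler_expR lnM ?posrE //.
have lnw : ln w <= w - 1 by have := @le_ln1Dx R (w - 1); rewrite addrCA subrr addr0; apply; lra.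
have l2 := ln2_ge.
have H : ln 2 + ln w <= w ^+ 2 * ln 2.
  apply: (@le_trans _ _ (ln 2 + (w - 1))); first by rewrite lerD2l.
  have : 0 <= (w - 1) * ((w + 1) * ln 2 - 1) by apply: mulr_ge0; [lra|nra].
  by nra.
have H0 : 0 <= ln 2 + ln w by rewrite addr_ge0 ?ln_ge0 //; lra.
apply: (@le_trans _ _ (2 * y * (w ^+ 2 * ln 2))); last by rewrite le_eqVlt; apply/orP; left; apply/eqP; ring.
by apply: ler_pM.
Qed.

Lemma leq_expn2r (a b e : nat) : (a <= b)%N -> (a ^ e <= b ^ e)%N.
Proof. by case: e => // e; rewrite leq_exp2r. Qed.

Lemma ffact_le_exp l d : (l ^_ d <= l ^ d)%N.
Proof.
elim: d l => [|d IH] [|l] //; rewrite ffactSS expnS leq_mul2l /=.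
by apply: leq_trans (IH l) _; apply: leq_expn2r.
Qed.

(* Equality holds at [d = 4]. *)
Lemma six_pow d : (0 < d)%N -> (2 * 6 ^ d <= 27 * d * d`!)%N.
Proof.
case: d => [|[|[|[|[|d]]]]] // _.
elim: d => // d IH; rewrite expnS factS mulnCA.
apply: leq_trans (_ : 6 * (27 * d.+4.+1 * d.+4.+1`!) <= _)%N; first by rewrite leq_mul2l IH orbT.
by nia.
Qed.

Lemma natr_le_expR_ln (m a : nat) b : (2 <= m)%N -> (a <= 2 ^ b)%N -> a%:R <= expR (b%:R * ln m%:R) :> R.
Proof.
move=> m2 ab; rewrite expRM_natl lnK ?posrE ?ltr0n //; last exact: leq_trans m2.
by rewrite -natrX ler_nat; apply: leq_trans ab _; exact: leq_expn2r.
Qed.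

(** The left side collects the number of configurations on [[0, l)] times the number of entries, the
    loss [m - 1] for the exceptional value, the decoupling factor and the supremum of the moment
    test function; the right side is [C ^ (1 / 2 ^ d)]. Every factor is bounded by a power of [m]
    and the exponents are added. *)
Lemma budget (d m k L : nat) (x : R) :
  (0 < d)%N -> (2 <= m)%N -> (d <= k)%N -> (2 <= L)%N -> 1 <= x -> L%:R <= 2 * x + 1 ->
  2 * ((m ^ 'C(k * L, d) * 'C(k * L, d))%:R * (m - 1)%:R) * (d * (k * L + 3))%:R * expR (2 * x * ln m%:R)
  <= expR (ln m%:R * (24 * d%:R * (k%:R * x / 2) ^+ d)).
Proof.
move=> d0 m2 dk L2 x1 Lx; set l := (k * L)%N; set M := 'C(l, d); set K := k%:R * x.
have k1 : (1 <= k)%N by exact: leq_trans dk.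
have lm : 2^-1 <= ln m%:R :> R.
  by apply: le_trans ln2_ge _; rewrite ler_ln ?posrE ?ltr0n ?ler_nat //; exact: leq_trans m2.
have k1R : 1 <= k%:R :> R by rewrite ler1n.
have kK : k%:R <= K by rewrite ler_peMr //; lra.
have xK : x <= K by rewrite ler_peMl //; lra.
have lK : l%:R <= 3 * K.
  rewrite /l natrM; apply: (@le_trans _ _ (k%:R * (2 * x + 1))); first by rewrite ler_wpM2l.
  by rewrite /K in kK *; lra.
have l2 : (2 <= l)%N by rewrite /l; nia.
have two : 2 <= expR (1%:R * ln m%:R) :> R by have := @natr_le_expR_ln m 2 1 m2 isT.
have mM : (m ^ M)%:R = expR (M%:R * ln m%:R) :> R.
  by rewrite expRM_natl lnK ?natrX // posrE ltr0n; exact: leq_trans m2.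
have m1 : (m - 1)%:R <= expR (1%:R * ln m%:R) :> R.
  by rewrite mul1r lnK ?posrE ?ltr0n ?ler_nat ?leq_subr //; exact: leq_trans m2.
have cost (b c : R) : M%:R <= expR (b * ln m%:R) -> (d * (l + 3))%:R <= expR (c * ln m%:R) ->
    2 + M%:R + b + 2 * x + c <= 24 * d%:R * (K / 2) ^+ d ->
    2 * ((m ^ M * M)%:R * (m - 1)%:R) * (d * (l + 3))%:R * expR (2 * x * ln m%:R)
    <= expR (ln m%:R * (24 * d%:R * (K / 2) ^+ d)).
  move=> Hb Hc Hsum; rewrite natrM mM.
  apply: (@le_trans _ _ (expR (1%:R * ln m%:R) * (expR (M%:R * ln m%:R) * expR (b * ln m%:R) * expR (1%:R * ln m%:R)) * expR (c * ln m%:R) * expR (2 * x * ln m%:R))).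
    by do ![apply: ler_pM => //; rewrite ?mulr_ge0 ?expR_ge0 ?ler0n //].
  rewrite -!expRD ler_expR.
  have -> : 1%:R * ln m%:R + (M%:R * ln m%:R + b * ln m%:R + 1%:R * ln m%:R) + c * ln m%:R + 2 * x * ln m%:R
     = ln m%:R * (2 + M%:R + b + 2 * x + c) by ring.
  by rewrite ler_wpM2l //; lra.
(* For [d = 1] the bounds [l <= 3 K] and [x <= K] make the exponents add up to exactly the available
   [12 K], so the estimates here have to be finer. *)
have [d1|d1] := eqVneq d 1%N.
  apply: (cost (l - 1)%:R (3 + 4 * (K - 1))).
  - apply: natr_le_expR_ln => //; rewrite /M d1 bin1.
    by case: (l) l2 => // l' _; rewrite subSS subn0 ltn_expl.
  - rewrite d1 mul1n mulrDl expRD.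
    have : 8 <= expR (3%:R * ln m%:R) :> R by apply: (@natr_le_expR_ln m 8 3).
    have : 1 + 4 * (K - 1) * ln m%:R <= expR (4 * (K - 1) * ln m%:R) by exact: expR_ge1Dx.
    have : 2 * (K - 1) <= 4 * (K - 1) * ln m%:R by rewrite (_ : 4 = 2 * 2) -?mulrA ?ler_wpM2l //; nra.
    rewrite natrD => H1 H2 H3.
    apply: (@le_trans _ _ (8 * (1 + 2 * (K - 1)))); first by lra.
    by apply: ler_pM => //; lra.
  rewrite d1 expr1 /M d1 bin1 natrB ?(leq_trans _ l2) //; lra.
have d2 : (2 <= d)%N by move: d0 d1; case: (d) => [|[|]].
apply: (cost l%:R (d + l.+1)%:R).
- apply: natr_le_expR_ln => //.
  have <- : #|[set A : {set 'I_l} | #|A| == d]| = M by rewrite card_draws card_ord.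
  apply: leq_trans (max_card _) _.
  by rewrite -cardsT -powersetT card_powerset cardsT card_ord.
- apply: natr_le_expR_ln => //; rewrite expnD leq_mul //; first by rewrite ltnW // ltn_expl.
  case: (l) l2 => [|[|l']] // _; elim: l' => // l' IH; rewrite expnS; lia.
have dK : d%:R <= K by apply: le_trans kK; rewrite ler_nat.
have d2R : 2 <= d%:R :> R by rewrite ler_nat.
have K2 : 1 <= K / 2 by lra.
have x2K : 2 * x <= K by rewrite /K ler_wpM2r ?ler_nat //; [lra|exact: leq_trans dk].
(* Here [l ^ d <= (3 K) ^ d = 6 ^ d (K / 2) ^ d], and [six_pow] compares [6 ^ d] with the factorial.
   The other exponents are at most [8 K + 3 <= 19 (K / 2) ^ d], within the remaining
   [21 / 2 d (K / 2) ^ d]. *)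
have Md : M%:R <= 27 / 2 * d%:R * (K / 2) ^+ d.
  have fd : 0 < (d`!)%:R :> R by rewrite ltr0n fact_gt0.
  rewrite -(ler_pM2r fd) -natrM bin_ffact.
  apply: (@le_trans _ _ (6 ^+ d * (K / 2) ^+ d)).
    rewrite -exprMn (_ : 6 * (K / 2) = 3 * K); last by field.
    apply: (@le_trans _ _ (l%:R ^+ d)); first by rewrite -natrX ler_nat ffact_le_exp.
    by rewrite lerXn2r ?nnegrE //; lra.
  have -> : 27 / 2 * d%:R * (K / 2) ^+ d * (d`!)%:R = 27 / 2 * d%:R * (d`!)%:R * (K / 2) ^+ d by ring.
  apply: ler_wpM2r; first by rewrite exprn_ge0 //; lra.
  have := six_pow d0; rewrite -(ler_nat R) !natrM natrX; lra.
have Kd : K / 2 <= (K / 2) ^+ d.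
  by rewrite -[leLHS]expr1 ler_weXn2l.
have : 2 * (K / 2) ^+ d <= d%:R * (K / 2) ^+ d by rewrite ler_wpM2r // exprn_ge0 //; lra.
rewrite -mulrA in Md *; rewrite natrD -natr1; lra.
Qed.

(** The factor [l + 2] in the radius [r], raised to the power [2 ^ d], has to absorb the constants
    of [box_le]. *)
Lemma box_size_le d l : (0 < d)%N -> (2 * d <= l)%N -> (2 * d * l + 3 + 2 * 2 ^ d <= (l + 2) ^ (2 ^ d))%N.
Proof.
case: d => // d _ dl.
apply: leq_trans (_ : (l + 2) ^ 2 * 4 ^ d <= _)%N; last first.
  apply: leq_trans (_ : (l + 2) ^ (2 + d) <= _)%N.
    by rewrite expnD leq_mul2l leq_expn2r ?orbT //; lia.
  rewrite leq_exp2l; last by lia.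
  by elim: (d) => // e IH; rewrite expnS; lia.
have h1 : (d.+1 <= 4 ^ d)%N by elim: (d) => // e IH; rewrite expnS; lia.
have h2 : (2 ^ d <= 4 ^ d)%N by apply: leq_expn2r.
rewrite expnS; have : ((l + 2) ^ 2 = l * l + 4 * l + 4)%N by rewrite -mulnn; lia.
move=> ->; nia.
Qed.

End Budget.

(** * Concentration of conditional expectations *)

Section ConditionalExpectation.
Variables (R : realType) (T : finType) (n d : nat) (P : config T n d -> R).
Hypothesis Ppmf : is_pmf P.
Implicit Types (f h : config T n d -> R) (J : {set 'I_n}).

Lemma agreeJP J (x y : config T n d) :
  reflect (forall s : dsub n d, val s \subset J -> x s = y s) (agreeJ J x y).
Proof.
apply: (iffP forallP) => H s; first by move=> sJ; have := H s; rewrite sJ => /eqP.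
by apply/implyP => sJ; apply/eqP; exact: H.
Qed.

Lemma agreeJC J (x y : config T n d) : agreeJ J x y = agreeJ J y x.
Proof. by apply: eq_forallb => s; rewrite eq_sym. Qed.

Lemma agreeJ_eq J (x x' : config T n d) : agreeJ J x x' -> agreeJ J x =1 agreeJ J x'.
Proof.
move=> /agreeJP xx' y; apply/agreeJP/agreeJP => H s sJ; first by rewrite -xx' ?H.
by rewrite xx' ?H.
Qed.

Lemma condE_agree f J (x x' : config T n d) : agreeJ J x x' -> condE P f J x = condE P f J x'.
Proof. by move=> xx'; rewrite /condE !(eq_bigl _ _ (agreeJ_eq xx')). Qed.

(** The defining property of conditional expectation; a double sum over pairs in a common atom is
    evaluated in both orders. *)
Lemma Ex_condE f h J : (forall x y, agreeJ J x y -> h x = h y) ->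
  Ex P (fun x => h x * condE P f J x) = Ex P (fun x => f x * h x).
Proof.
move=> hJ; pose W x := \sum_(y | agreeJ J x y) P y.
have WJ x y : agreeJ J x y -> W x = W y by move=> xy; rewrite /W (eq_bigl _ _ (agreeJ_eq xy)).
transitivity (\sum_x \sum_(y | agreeJ J x y) P x * (h y / W y) * (P y * f y)).
  apply: eq_bigr => x _; rewrite /condE -/(W x).
  transitivity (P x * (h x / W x) * \sum_(y | agreeJ J x y) P y * f y); first by ring.
  by rewrite mulr_sumr; apply: eq_bigr => y xy; rewrite (hJ x y xy) (WJ x y xy).
rewrite (exchange_big_dep predT) //=; apply: eq_bigr => y _.
rewrite (eq_bigl (agreeJ J y)) => [|x]; last by rewrite agreeJC.
(* On a null atom both sides vanish, because [P y <= W y = 0]. *)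
rewrite -!mulr_suml -/(W y); have [W0|W0] := eqVneq (W y) 0; last by field.
have -> : P y = 0; last by rewrite !mul0r mulr0.
case: Ppmf => P0 _; apply/eqP; rewrite eq_le P0 andbT -W0 /W.
by rewrite (bigD1 y) ?lerDl ?sumr_ge0 //; apply/agreeJP.
Qed.

Lemma ltr_sqr_Ex_norm (g : config T n d -> R) (eps : R) : 0 < eps ->
  Prob P (fun x => `|g x| <= eps) < 1 - eps -> eps ^+ 2 < Ex P (fun x => `|g x|).
Proof.
move=> e0 H.
have step : Ex P (fun x => eps * (1 - (`|g x| <= eps)%R%:R)) <= Ex P (fun x => `|g x|).
  apply: ler_Ex => // x; case: (leP `|g x| eps) => /= h; first by rewrite subrr mulr0.
  by rewrite subr0 mulr1 ltW.
apply: lt_le_trans step.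
by rewrite ExZ ExB Ex_cst // -ProbE expr2 ltr_pM2l //; lra.
Qed.

(** Hoelder's inequality in normalized form: Young's inequality for [|f|] and [|S| / t], whose
    weights [1 / p] and [1 / q] sum to 1. *)
Lemma young_Lpnorm f (S : config T n d -> R) p t : 1 < p -> 0 < t -> Lpnorm P f p = 1 ->
  Ex P (fun x => (`|S x| / t) `^ (p / (p - 1))) <= 1 -> Ex P (fun x => f x * S x) <= t.
Proof.
move=> p1 t0 fp Sq; have p0 : 0 < p by lra.
have p10 : 0 < p - 1 by lra.
have q0 : 0 < p / (p - 1) by rewrite divr_gt0.
have pq : p^-1 + (p / (p - 1))^-1 = 1 by field; lra.
have fp1 : Ex P (fun x => `|f x| `^ p) = 1.
  move/eqP: fp; rewrite /Lpnorm -/(Ex P _) powR_eq1 invr_eq0 (gt_eqF p0) orbF => /orP[/eqP //|].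
  by rewrite ltNge Ex_ge0 // => x; exact: powR_ge0.
apply: (@le_trans _ _ (Ex P (fun x => t * (p^-1 * (`|f x| `^ p) + (p / (p - 1))^-1 * ((`|S x| / t) `^ (p / (p - 1))))))).
  apply: ler_Ex => // x.
  have := @conjugate_powR R `|f x| (`|S x| / t) _ _ (normr_ge0 _) (divr_ge0 (normr_ge0 _) (ltW t0)) p0 q0 pq.
  rewrite mulrC [X in _ <= X + _]mulrC [X in _ <= _ + X]mulrC => H.
  have := ler_wpM2l (ltW t0) H; apply: le_trans.
  have -> : t * (`|S x| / t * `|f x|) = `|f x * S x| by rewrite normrM; field; lra.
  exact: ler_norm.
rewrite ExZ ExD !ExZ fp1 mulr1.
apply: (@le_trans _ _ (t * (p^-1 + (p / (p - 1))^-1))); last by rewrite pq mulr1.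
apply: ler_wpM2l; first exact: ltW.
by rewrite lerD2l; apply: ler_piMr => //; rewrite invr_ge0 ltW.
Qed.

End ConditionalExpectation.

(** * Restriction to an initial segment and its blocks *)

Section Lift.
Variables (T : finType) (d l n : nat) (ln : (l <= n)%N) (a0 : T).

Lemma widen_incr : strictly_increasing (widen_ord ln).
Proof. by []. Qed.

Definition initial (x : config T n d) : config T l d := pull (increasing_inj widen_incr) x.

(** Extending by the filler [a0] turns a function of the entries inside [[0, l)] into one on
    [config T l d], where the product law lives. *)
Definition lift_config (y : config T l d) : config T n d :=
  [ffun s => if [pick t : dsub l d | widen_ord ln @: val t == val s] is Some t then y t else a0].

Lemma lift_initial (x : config T n d) (s : dsub n d) :
  (forall v, v \in val s -> (v < l)%N) -> lift_config (initial x) s = x s.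
Proof.
move=> sl; rewrite ffunE; case: pickP => [t /eqP ts|H]; first exact: pullE.
have E : widen_ord ln @: (widen_ord ln @^-1: val s) = val s.
  apply/setP => v; apply/imsetP/idP => [[w ws ->]|vs]; first by move: ws; rewrite inE.
  have wv : widen_ord ln (Ordinal (sl v vs)) = v by apply: val_inj.
  by exists (Ordinal (sl v vs)); rewrite ?inE wv.
have ct : #|widen_ord ln @^-1: val s| == d.
  by rewrite -(card_imset _ (increasing_inj widen_incr)) E; exact: valP s.
pose t : dsub l d := exist _ (widen_ord ln @^-1: val s) ct.
by have := H t; rewrite /= E eqxx.
Qed.

Definition in_block k j : pred (dsub l d) :=
  fun t => [forall v in val t, (j * k <= v < j.+1 * k)%N].

Lemma in_block_inj k t j j' : (0 < d)%N -> in_block k j t -> in_block k j' t -> j = j'.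
Proof.
move=> d0 /forallP H /forallP H'.
have [v vt] : exists v, v \in val t by apply/card_gt0P; rewrite (eqP (valP t)).
have /implyP/(_ vt)/andP[h1 h2] := H v; have /implyP/(_ vt)/andP[h3 h4] := H' v.
have lt1 : (j * k < j'.+1 * k)%N by exact: leq_ltn_trans h1 h4.
have lt2 : (j' * k < j.+1 * k)%N by exact: leq_ltn_trans h3 h2.
by move: lt1 lt2; rewrite !ltn_mul2r => /andP[_ ?] /andP[_ ?]; lia.
Qed.

Lemma lift_agree k j (J : {set 'I_n}) (y z : config T l d) :
  (forall v, v \in J -> (j * k <= v < j.+1 * k)%N) ->
  (forall t, in_block k j t -> y t = z t) -> agreeJ J (lift_config y) (lift_config z).
Proof.
move=> Jb yz; apply/agreeJP => s sJ; rewrite !ffunE; case: pickP => // t /eqP ts.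
apply: yz; apply/forallP => v; apply/implyP => vt; apply: (Jb (widen_ord ln v)).
by apply: (fintype.subsetP sJ); rewrite -ts imset_f.
Qed.

End Lift.

(** * Contradiction from large conditional expectations on all blocks *)

Section Main.
Variable R : realType.

(** This exhibits [C] as a [2 ^ d]-th power; the corresponding root is what [d] Cauchy-Schwarz steps
    lose. *)
Lemma constCE (d m k : nat) (p eps : R) :
  constC d m k p eps =
  expR ((2 ^ d)%:R * (ln m%:R * (24 * d%:R * (k%:R * (eps ^+ 4 * (p - 1))^-1 / 2) ^+ d))).
Proof.
rewrite /constC; congr expR.
rewrite exprM -exprMn; move: (eps ^+ 4 * (p - 1)) => A.
rewrite natrX !exprMn !exprVn; have : (2 : R) ^+ d != 0 by rewrite expf_neq0.
by move: (2 ^+ d) (_^-1) => z a z0; field.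
Qed.

Lemma law_initial (T : finType) (d l n : nat) (ln : (l <= n)%N) (P : config T n d -> R) G :
  Ex (fun y => Ex P (fun x => (initial ln x == y)%:R)) G = Ex P (fun x => G (initial ln x)).
Proof.
rewrite /Ex; under eq_bigr => y _ do rewrite mulr_suml.
rewrite exchange_big /=; apply: eq_bigr => x _.
rewrite (bigD1 (initial ln x)) //= eqxx mulr1 big1 ?addr0 // => y.
by rewrite eq_sym => /negbTE ->; rewrite mulr0 mul0r.
Qed.

Lemma pmf_law_initial (T : finType) (d l n : nat) (ln : (l <= n)%N) (P : config T n d -> R) :
  is_pmf P -> pmf (fun y => Ex P (fun x => (initial ln x == y)%:R)).
Proof.
move=> Ppmf; split=> [y|]; first by apply: Ex_ge0.
have := law_initial ln P (fun=> 1); rewrite (Ex_cst _ Ppmf) => {2}<-.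
by apply: eq_bigr => y _; rewrite mulr1.
Qed.

(* A law on arrays over [0, l) close to the i.i.d. one leaves no room for [L] conditional
   expectations, over [L] consecutive blocks, to have large [L_1] norms: testing [f] against the sum
   of their signs contradicts the moment bound. *)
Lemma block_with_small_condE (T : finType) (d k L n : nat) (P : config T n d -> R) (pi : T -> R)
    (p eps tau : R) (f : config T n d -> R) (a0 : T) (ln : (k * L <= n)%N) :
  (0 < d)%N -> is_pmf P -> pmf pi -> 1 < p -> p <= 2 -> 0 < eps -> eps <= 1 ->
  2 <= L%:R * (eps ^+ 4 * (p - 1)) ->
  \sum_y `|Ex P (fun x => (initial ln x == y)%:R) - iid pi y| <= tau ->
  (2 / eps ^+ 2) `^ (p / (p - 1)) * tau <= 2^-1 ->
  Expect P f = 0 -> Lpnorm P f p = 1 ->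
  exists2 j : 'I_L, True & forall J : {set 'I_n},
    J \subset [set u : 'I_n | (j * k <= u < j.+1 * k)%N] ->
    Prob P (fun x => `|condE P f J x| <= eps) >= 1 - eps.
Proof.
move=> d0 Ppmf pi_pmf p1 p2 e0 e1 HL Htau Hbud f0 fp; apply: contrapT => Hno.
have p10 : 0 < p - 1 by rewrite subr_gt0.
have e40 : 0 < eps ^+ 4 * (p - 1) by rewrite mulr_gt0 ?exprn_gt0.
have L0 : 0 < L%:R :> R by rewrite -(pmulr_lgt0 _ e40); lra.
have : forall j : 'I_L, exists J : {set 'I_n},
    J \subset [set u : 'I_n | (j * k <= u < j.+1 * k)%N] /\
    Prob P (fun x => `|condE P f J x| <= eps) < 1 - eps.
  move=> j; apply: contrapT => Hj; apply: Hno; exists j => // J HJ.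
  by rewrite leNgt; apply/negP => lt; apply: Hj; exists J.
move=> /choice [J HJ].
have Jb j v : v \in J j -> (j * k <= v < j.+1 * k)%N.
  by have [/fintype.subsetP/(_ v) H _] := HJ j => /H; rewrite inE.
pose h (j : 'I_L) x := Num.sg (condE P f (J j) x).
have hJ j x y : agreeJ (J j) x y -> h j x = h j y by move=> xy; rewrite /h (condE_agree P f xy).
pose H (j : 'I_L) (y : config T (k * L) d) := h j (lift_config ln a0 y).
have hH j x : h j x = H j (initial ln x).
  apply: hJ; apply/agreeJP => s sJ; rewrite lift_initial // => v vs.
  have /andP[_ vk] := Jb j v (fintype.subsetP sJ v vs).
  apply: leq_trans vk _; rewrite mulnC leq_mul2l; apply/orP; right; exact: ltn_ord.
have HA (j : 'I_L) : depends_on (in_block k j) (H j).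
  move=> y z yz; apply: hJ; apply: (lift_agree ln) yz => v; exact: Jb.
have H1 (j : 'I_L) y : `|H j y| <= 1 by rewrite /H /h normr_sg; case: (_ != _); rewrite ?lexx ?ler01.
have disj (t : dsub (k * L) d) (j j' : 'I_L) : in_block k j t -> in_block k j' t -> j = j'.
  by move=> a b; apply: val_inj; exact: in_block_inj a b.
set t := L%:R * eps ^+ 2; have t0 : 0 < t by rewrite mulr_gt0 ?exprn_gt0.
pose S (y : config T (k * L) d) := centered_sum pi H y.
have mom := moment_centered_sum pi_pmf disj HA H1 p1 p2 e0 HL.
pose G (y : config T (k * L) d) := (`|S y| / t) `^ (p / (p - 1)).
have q0 : 0 < p / (p - 1) by rewrite divr_gt0 //; lra.
have nu_pmf := iid_pmf pi_pmf (dsub (k * L) d).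
(* The sum has [L] terms of modulus at most 2, while [t = L eps ^ 2]. *)
have G01 y : 0 <= G y <= (2 / eps ^+ 2) `^ (p / (p - 1)).
  rewrite powR_ge0 /=; apply: (ge0_ler_powR (ltW q0)).
  - by rewrite nnegrE divr_ge0 // ltW.
  - by rewrite nnegrE divr_ge0 // ltW // exprn_gt0.
  rewrite ler_pdivrMr // /t mulrCA divfK ?expf_neq0 ?gt_eqF //.
  apply: le_trans (ler_norm_sum _ _ _) _.
  rewrite mulrC mulr_natr -[X in _ *+ X]card_ord -sumr_const; apply: ler_sum => j _.
  apply: le_trans (ler_normB _ _) _; have := ler_norm_Ex nu_pmf (H1 j); have := H1 j y; lra.
(* The moment is at most [3 / 4] under the product law, and by [Hbud] the distance of the laws adds
   at most [1 / 4]. *)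
have Gle : Ex P (fun x => G (initial ln x)) <= 1.
  rewrite -law_initial.
  apply: le_trans (Ex_le_tv (pmf_law_initial ln Ppmf) nu_pmf G01) _.
  have e83 := expR1_ge R; have eN : expR (- 1) <= 3 / 8 :> R.
    by rewrite expRN; apply: le_trans (_ : (8 / 3)^-1 <= _); [rewrite lef_pV2 ?posrE ?expR_gt0 //; lra|lra].
  set s := (2 / eps ^+ 2) `^ _ in Hbud *.
  have s0 : 0 <= s by exact: powR_ge0.
  have : s / 2 * \sum_y `|Ex P (fun x => (initial ln x == y)%:R) - iid pi y| <= s / 2 * tau.
    by apply: ler_wpM2l => //; lra.
  have : Ex (iid pi (I:=dsub (k * L) d)) G <= 2 * expR (- 1) by exact: mom.
  lra.
have := young_Lpnorm Ppmf p1 t0 fp Gle; apply/negP; rewrite -ltNge.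
(* The centering constants disappear because [f] has mean 0, and the sign turns each remaining term
   into an [L_1] norm. *)
have -> : Ex P (fun x => f x * S (initial ln x)) = \sum_(j < L) Ex P (fun x => `|condE P f (J j) x|).
  transitivity (\sum_(j < L) (Ex P (fun x => f x * h j x) - Ex P f * Ex (iid pi (I:=dsub (k * L) d)) (H j))).
    rewrite /Ex; under [RHS]eq_bigr => j _ do rewrite mulr_suml -sumrB.
    rewrite exchange_big /=; apply: eq_bigr => x _.
    rewrite /S /centered_sum mulrA mulr_sumr; apply: eq_bigr => j _.
    by rewrite hH mulrBr mulrA.
  apply: eq_bigr => j _; rewrite (_ : Ex P f = 0) // mul0r subr0.
  rewrite -(Ex_condE Ppmf f (hJ j)); apply: eq_Ex => x.
  by rewrite /h -normrEsg.
rewrite /t mulr_natl -[X in _ *+ X]card_ord -sumr_const.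
have Lpos : (0 < L)%N by rewrite -(ltr0n R).
apply: ltr_sum => [|j _]; first by apply/hasP; exists (Ordinal Lpos); rewrite ?mem_index_enum.
by apply: ltr_sqr_Ex_norm => //; have [] := HJ j.
Qed.

End Main.

(** [r] is the radius for [decoupling]. The conclusions serve, in order, to fit [[0, l)] into
    [[0, n)], to meet the condition on [r] in [one_site], and to keep the total variation error
    times the supremum of the moment test function below one half. *)
Lemma budget_consequences (R : realType) (d m k L : nat) (x eta : R) :
  (0 < d)%N -> (2 <= m)%N -> (d <= k)%N -> (2 <= L)%N -> 1 <= x -> L%:R <= 2 * x + 1 ->
  let l := (k * L)%N in
  let E := ln m%:R * (24 * d%:R * (k%:R * x / 2) ^+ d) in
  let r := (l + 2)%:R * expR (- E) in
  eta = (expR ((2 ^ d)%:R * E))^-1 ->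
  [/\ l%:R <= eta^-1,
      (2 * d%:R * l%:R + 3 + 2 * 2 ^+ d) * eta <= r ^+ (2 ^ d)%N &
      (m ^ 'C(l, d) * 'C(l, d))%:R * ((m - 1)%:R * (4 * eta + d%:R * r)) * expR (2 * x * ln m%:R) <= 2^-1].
Proof.
move=> d0 m2 dk L2 x1 Lx l E r eta_def.
have := budget d0 m2 dk L2 x1 Lx; rewrite -/l -/E.
set M := 'C(l, d); set a : R := (m ^ M * M)%:R * (m - 1)%:R; set b : R := (d * (l + 3))%:R; set e := expR (2 * x * _) => Hb.
have dl : (2 * d <= l)%N by rewrite /l mulnC leq_mul.
have a1 : 1 <= a.
  rewrite /a -natrM ler1n muln_gt0 muln_gt0 expn_gt0 bin_gt0 subn_gt0 m2 (ltnW m2) /=.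
  by rewrite (leq_trans _ dl) // leq_pmull.
have b1 : (l + 3)%:R <= b by rewrite /b ler_nat leq_pmull.
have b0 : 5 <= b by apply: le_trans b1; rewrite ler_nat; move: dl d0; clear; lia.
have e1 : 1 <= e.
  by rewrite -expR0 ler_expR mulr_ge0 ?ln_ge0 ?ler1n ?(leq_trans _ m2) //; lra.
have bE : 2 * b <= expR E.
  apply: le_trans Hb; rewrite -mulrA; apply: (@le_trans _ _ (2 * a * b)); last first.
    by rewrite ler_wpM2l ?ler_peMr //; lra.
  by rewrite mulrAC; apply: ler_peMr; lra.
set rho := expR (- E) in r *.
have rhoE : rho * expR E = 1 by rewrite /rho -expRD addNr expR0.
have rho0 : 0 < rho by exact: expR_gt0.
have rho4 : rho <= 4^-1.
  by rewrite /rho expRN lef_pV2 ?posrE ?expR_gt0 //; lra.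
have etaX : eta = rho ^+ (2 ^ d)%N by rewrite eta_def -expRN -mulrN expRM_natl.
have eta_rho : 4 * eta <= rho.
  have : eta <= rho ^+ 2.
    rewrite etaX ler_wiXn2l ?(ltW rho0) //; first by lra.
    by case: (d) d0 => // d' _; rewrite expnS leq_pmulr ?expn_gt0.
  by rewrite expr2; nra.
split.
- have -> : eta^-1 = expR ((2 ^ d)%:R * E) by rewrite eta_def invrK.
  apply: (@le_trans _ _ (expR E)); first by move: b1; rewrite natrD; lra.
  have E0 : 0 <= E by rewrite -ler_expR expR0; lra.
  by rewrite ler_expR ler_peMl // ler1n expn_gt0.
- rewrite /r exprMn -etaX; apply: ler_wpM2r; first by rewrite etaX exprn_ge0 ?ltW.
  apply: (@le_trans _ _ (2 * d * l + 3 + 2 * 2 ^ d)%:R); first last.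
    by rewrite -natrX ler_nat; exact: box_size_le.
  by rewrite (natrD _ (2 * d * l + 3)) (natrD _ (2 * d * l)) (natrM _ 2 (2 ^ d)) natrX (natrM _ (2 * d)) (natrM _ 2 d).
apply: (@le_trans _ _ (a * (b * rho) * e)).
  apply: ler_wpM2r; first by lra.
  rewrite mulrA -/a; apply: ler_wpM2l; first by lra.
  have d1 : 1 <= d%:R :> R by rewrite ler1n.
  have dr : rho <= d%:R * rho by rewrite ler_peMl // ltW.
  by rewrite /r /b (natrM _ d) (natrD _ l 2) (natrD _ l 3); lra.
have := ler_wpM2l (ltW rho0) Hb; rewrite rhoE; lra.
Qed.

Theorem theorem6p1 (R : realType) (d m : nat) (p eps : R) (k n : nat)
  (T : finType) (P : config T n d -> R) (S : {set T}) :
  (0 < d)%N -> (2 <= m)%N -> 1 < p -> p <= 2 -> 0 < eps -> eps <= 1 ->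
  (d <= k)%N ->
  constC d m k p eps <= n%:R ->
  #|T| = m ->
  is_pmf P ->
  spreadable P (constC d m k p eps)^-1 ->
  #|S| = (#|T| - 1)%N ->
  (forall a, a \in S ->
     `| Prob P (fun x => [forall s : dsub n d, inBox s ==> (x s == a)])
        - \prod_(s : dsub n d | inBox s) Prob P (fun x => x s == a) |
     <= (constC d m k p eps)^-1) ->
  forall f : config T n d -> R,
    Expect P f = 0 -> Lpnorm P f p = 1 ->
    exists I : {set 'I_n}, is_interval_of_size I k /\
      forall J : {set 'I_n}, J \subset I -> (d <= #|J|)%N ->
        Prob P (fun x => `|condE P f J x| <= eps) >= 1 - eps.
Proof.
move=> d0 m2 p1 p2 e0 e1 dk Cn Tm Ppmf Psp cS HS f f0 fp.
set x := (eps ^+ 4 * (p - 1))^-1.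
have p10 : 0 < p - 1 by rewrite subr_gt0.
have e40 : 0 < eps ^+ 4 * (p - 1) by rewrite mulr_gt0 ?exprn_gt0.
have x1 : 1 <= x.
  rewrite /x invf_ge1 //; apply: mulr_ile1; [exact: exprn_ge0 (ltW e0)|lra|by rewrite exprn_ile1 // ltW|lra].
(* This gives [2 x < L <= 2 x + 1]: the moment bound needs the lower estimate, the budget the upper
   one. *)
pose L := (Num.truncn (2 * x)).+1.
have x20 : 0 <= 2 * x by lra.
have /andP[tr1 tr2] := truncn_itv x20; rewrite -/L in tr2.
have Lx : L%:R <= 2 * x + 1 by rewrite /L -natr1; lra.
have L2 : (2 <= L)%N by rewrite -(ler_nat R); lra.
have HL : 2 <= L%:R * (eps ^+ 4 * (p - 1)).
  by rewrite -ler_pdivrMr // -/x ltW.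
set l := (k * L)%N.
set E := ln m%:R * (24 * d%:R * (k%:R * x / 2) ^+ d).
set eta := (constC d m k p eps)^-1 in Psp HS.
have etaE : eta = (expR ((2 ^ d)%:R * E))^-1 by rewrite /eta constCE.
have [lC Hbox Htv] := budget_consequences d0 m2 dk L2 x1 Lx etaE.
set r := (l + 2)%:R * expR (- E) in Hbox Htv.
have eta0 : 0 < eta by rewrite etaE invr_gt0 expR_gt0.
have Cn' : eta^-1 <= n%:R by rewrite /eta invrK.
have ln : (l <= n)%N by rewrite -(ler_nat R); apply: le_trans Cn'.
have dl : (2 * d <= l)%N by rewrite /l mulnC leq_mul.
have dln : (2 * d <= n)%N by exact: leq_trans dl ln.
have l0 : (0 < l)%N by apply: leq_trans dl; rewrite muln_gt0.
(* The [l] intervals get the largest common length [n %/ l], written as a successor so that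
   ['I_N'.+1] is inhabited. *)
pose N' := (n %/ l).-1.
have NE : N'.+1 = (n %/ l)%N by rewrite prednK // divn_gt0.
have lNn : (l * N'.+1 <= n)%N by rewrite NE mulnC leq_divM.
(* Rounding [n / l] down loses at most a factor 2, and [n >= C = 1 / eta]. *)
have Nbig : d%:R / N'.+1%:R <= 2 * d%:R * l%:R * eta.
  have n2 : n%:R <= 2 * (N'.+1%:R * l%:R) :> R.
    have := ltn_ceil n l0; rewrite -NE => H.
    by rewrite -!natrM ler_nat; apply: leq_trans (ltnW H) _; rewrite mulSn mul2n -addnn leq_add2r leq_pmull.
  have N0 : 0 < N'.+1%:R :> R by rewrite ltr0n.
  have H1 : eta^-1 <= 2 * (N'.+1%:R * l%:R) by exact: le_trans Cn' n2.
  rewrite ler_pdivrMr //.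
  have := ler_wpM2l (ltW eta0) H1; rewrite mulfV ?gt_eqF // => H2.
  have := ler_wpM2l (ler0n R d) H2; lra.
have Hr : d%:R / N'.+1%:R + 2 * eta + eta + (2 ^ d)%:R * (2 * eta) <= r ^+ (2 ^ d)%N.
  apply: le_trans Hbox; rewrite natrX -/l; move: Nbig.
  by move: (2 ^+ d) (d%:R / _) => z w Nw; lra.
have r0 : 0 <= r by rewrite mulr_ge0 ?expR_ge0.
have dl' : (d <= l)%N by apply: leq_trans dl; rewrite leq_pmull.
pose st : dsub n d := boxset dln [ffun=> false].
pose pi a := Prob P (fun y => y st == a).
have pi_pmf : pmf pi.
  split=> [a|]; first by have /andP[] := Prob01 Ppmf (fun y => y st == a).
  rewrite /pi; under eq_bigr => a _ do rewrite ProbE.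
  rewrite exchange_big /= -[RHS](proj2 Ppmf); apply: eq_bigr => y _.
  rewrite -mulr_sumr (bigD1 (y st)) //= eqxx big1 ?addr0 ?mulr1 // => a.
  by rewrite eq_sym => /negbTE ->.
have g0 : 0 <= 4 * eta + d%:R * r by rewrite addr_ge0 ?mulr_ge0 // ltW.
have m1 : 1 <= (m - 1)%:R :> R by rewrite ler1n subn_gt0.
have site a s0 (D : seq (dsub l d)) c : s0 \notin D ->
    `|Ex P (fun y => ((initial ln y s0 == a)%:R - pi a) * \prod_(t <- D) (initial ln y t == c t)%:R)|
    <= (m - 1)%:R * (4 * eta + d%:R * r).
  move=> s0D.
  have inS b : b \in S ->
      `|Ex P (fun y => ((initial ln y s0 == b)%:R - pi b) * \prod_(t <- D) (initial ln y t == c t)%:R)|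
      <= 4 * eta + d%:R * r.
    by move=> bS; apply: (one_site d0 lNn dln Ppmf Psp (ltW eta0) st c s0D r0 dl' (HS b bS) Hr (@widen_incr l n ln)).
  (* The value outside [S] costs the factor [m - 1], which is granted to all values for
     uniformity. *)
  have [aS|aS] := boolP (a \in S); first by apply: le_trans (inS a aS) _; exact: ler_peMl.
  by rewrite -[in leRHS]Tm; apply: (missing_value (X := fun y => initial ln y s0) pi_pmf cS aS).
have tv := iid_approx Ppmf pi_pmf site.
have cI : #|{: dsub l d}| = 'C(l, d).
  by rewrite card_sig -[in RHS](card_ord l) -card_draws; apply: eq_card => A; rewrite !inE.
rewrite Tm cI in tv.
have [a0 _] : exists a0 : T, a0 \in predT by apply/card_gt0P; rewrite Tm (leq_trans _ m2).
have Hbud : (2 / eps ^+ 2) `^ (p / (p - 1)) *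
    ((m ^ 'C(l, d) * 'C(l, d))%:R * ((m - 1)%:R * (4 * eta + d%:R * r))) <= 2^-1.
  apply: le_trans Htv; rewrite mulrC; apply: ler_wpM2l.
    by rewrite mulr_ge0 // mulr_ge0 //; lra.
  have w1 : 1 <= (eps ^+ 2)^-1 by rewrite invf_ge1 ?exprn_gt0 // exprn_ile1 // ltW.
  have q0 : 0 <= p / (p - 1) by rewrite divr_ge0 ?ltW //; lra.
  have qy : p / (p - 1) <= 2 * (p - 1)^-1 by rewrite ler_wpM2r // invr_ge0 ltW.
  apply: le_trans (two_powR_le w1 q0 qy) _; rewrite ler_expR.
  have -> : (eps ^+ 2)^-1 ^+ 2 * (p - 1)^-1 = x by rewrite /x; field; rewrite !gt_eqF.
  apply: ler_wpM2l => //; rewrite ler_ln ?posrE ?ltr0n ?ler_nat //; exact: leq_trans m2.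
have [j _ Hj] := block_with_small_condE a0 d0 Ppmf pi_pmf p1 p2 e0 e1 HL tv Hbud f0 fp.
exists [set u : 'I_n | (j * k <= u < j.+1 * k)%N]; split; last by move=> J HJ _; exact: Hj.
exists (j * k)%N; have E1 : (j * k + k = j.+1 * k)%N by rewrite mulSn addnC.
rewrite E1; split=> //; apply: (leq_trans _ ln); rewrite /l mulnC leq_mul2l; apply/orP; right; exact: ltn_ord.
Qed.
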